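(* Let $R$ be a semilocal commutative ring with $2\in R^\times$ and let $A$ be an Azumaya $R$-algebra. Then there exists an idempotent $e\in A$ such that $eAe\in[A]$ (i.e. $eAe$ is an Azumaya $R$-algebra Brauer equivalent to $A$) and $\mathrm{rrk}_A\,eA=\deg eAe=\mathrm{ind}\,A$.
   Context: $[A]$ denotes the class of $A$ in the Brauer group $\mathrm{Br}\,R$. For an Azumaya $R$-algebra $A$, $\deg A=\sqrt{\mathrm{rk}_RA}$, and $\mathrm{ind}\,A=\gcd\{\deg A':A'\in[A]\}$. For a finitely generated projective right $A$-module $P$, the reduced rank is $\mathrm{rrk}_AP=\mathrm{rk}_RP/\deg A$. All of these are locally constant functions $\mathrm{Spec}\,R\to\mathbb Z$, and gcd and equalities are understood pointwise. The paper assumes throughout that $2$ is invertible in all rings. *)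

(* Defs.v *)
From HB Require Import structures.
From mathcomp Require Import all_boot all_order all_algebra.
From mathcomp Require Import boolp classical_sets cardinality.

Set Implicit Arguments.
Unset Strict Implicit.
Unset Printing Implicit Defensive.

Import GRing.Theory.
Local Open Scope classical_set_scope.
Local Open Scope ring_scope.

Section Rings.
Variable R : comNzRingType.

(* idealr_closed includes properness (1 \notin m). *)
Definition maximal_ideal (m : pred R) : Prop :=
  idealr_closed m /\
  forall I : pred R, idealr_closed I -> {subset m <= I} -> {subset I <= m}.

Definition semilocal : Prop := finite_set [set m : pred R | maximal_ideal m].

End Rings.

(* The points of Spec R are the prime ideals, of type prime_idealr R. *)

Section Modules.
Variable R : comNzRingType.

(* M is a direct summand of some R^n *)
Definition fg_projective (M : lmodType R) : Prop :=
  exists (n : nat) (i : {linear M -> 'rV[R]_n}) (r : {linear 'rV[R]_n -> M}),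
    cancel i r.

Definition faithful (M : lmodType R) : Prop :=
  forall r : R, (forall x : M, r *: x = 0) -> r = 0.

(* The images of the x_i in the localization M_p form a basis over R_p, with
   denominators cleared: m/1 = \sum_i (c_i/s) (x_i/1) up to enlarging s, and a
   relation \sum_i (c_i/1) (x_i/1) = 0 comes, after multiplying the c_i by an
   element outside p, from a relation in M. *)
Definition local_basis (p : prime_idealr R) (M : lmodType R) (n : nat)
    (x : 'I_n -> M) : Prop :=
  (forall m : M, exists (s : R) (c : 'I_n -> R),
     s \notin p /\ s *: m = \sum_i c i *: x i) /\
  (forall c : 'I_n -> R, \sum_i c i *: x i = 0 ->
     forall i, exists2 t : R, t \notin p & t * c i = 0).

(* The rank over R_p of the free module M_p; any basis of M_p can be rescaled
   to one coming from M.  The value is 0 by convention if M_p is not free of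
   finite rank, which does not happen for M finitely generated projective. *)
Definition rk (M : lmodType R) (p : prime_idealr R) : nat :=
  xget 0%N [set n | exists x : 'I_n -> M, local_basis p x].

(* (T, b) is a tensor product of M and N over R *)
Definition is_tensor_product (M N T : lmodType R) (b : M -> N -> T) : Prop :=
  bilinear_for *:%R *:%R b /\
  forall (V : lmodType R) (f : M -> N -> V), bilinear_for *:%R *:%R f ->
    exists! g : T -> V, linear g /\ forall x y, g (b x y) = f x y.

End Modules.

(* C is isomorphic to the tensor product algebra of A and B over R *)
Definition is_tensor_algebra (R : comNzRingType) (A B C : algType R) : Prop :=
  exists (i : {lrmorphism A -> C}) (j : {lrmorphism B -> C}),
    (forall a b, i a * j b = j b * i a) /\
    is_tensor_product (fun a b => i a * j b).

(* End_R(P), for P faithful; the proof only serves to guarantee that this ring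
   is nonzero, as algType requires. *)
Definition end_alg (R : comNzRingType) (P : lmodType R) (fP : faithful P) :=
  {linear P -> P}.

Section EndAlg.
Variables (R : comNzRingType) (P : lmodType R) (fP : faithful P).

HB.instance Definition _ := gen_eqMixin (end_alg fP).
HB.instance Definition _ := gen_choiceMixin (end_alg fP).

Implicit Types f g h : end_alg fP.

Definition end_app f : P -> P := (f : {linear P -> P}).

Lemma end_alg_ext f g : end_app f =1 end_app g -> f = g.
Proof.
case: f g => [f [[[f1 f2]] [f3]]] [g [[[g1 g2]] [g3]]] /funext.
rewrite /end_app /= => fg; case: _ / fg in g1 g2 g3 *.
by congr (GRing.Linear.Pack (GRing.Linear.Class _ _)); congr (_ _);
  apply: Prop_irrelevance.
Qed.

Definition end_zero : end_alg fP := (\0 : P -> P) : {linear P -> P}.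
Definition end_opp f : end_alg fP := (\- end_app f) : {linear P -> P}.
Definition end_add f g : end_alg fP := (f \+ g) : {linear P -> P}.
Definition end_one : end_alg fP := (idfun : P -> P) : {linear P -> P}.
Definition end_mul f g : end_alg fP := (f \o g) : {linear P -> P}.
Definition end_scale (r : R) f : end_alg fP := (r \*: f) : {linear P -> P}.

Fact end_addA : associative end_add.
Proof. by move=> f g h; apply: end_alg_ext => x; apply: addrA. Qed.

Fact end_addC : commutative end_add.
Proof. by move=> f g; apply: end_alg_ext => x; apply: addrC. Qed.

Fact end_add0 : left_id end_zero end_add.
Proof. by move=> f; apply: end_alg_ext => x; apply: add0r. Qed.

Fact end_addN : left_inverse end_zero end_opp end_add.
Proof. by move=> f; apply: end_alg_ext => x; apply: addNr. Qed.

HB.instance Definition _ := GRing.isZmodule.Build (end_alg fP)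
  end_addA end_addC end_add0 end_addN.

Fact end_mulA : associative end_mul.
Proof. by move=> f g h; apply: end_alg_ext. Qed.

Fact end_mul1f : left_id end_one end_mul.
Proof. by move=> f; apply: end_alg_ext. Qed.

Fact end_mulf1 : right_id end_one end_mul.
Proof. by move=> f; apply: end_alg_ext. Qed.

Fact end_mulDl : left_distributive end_mul +%R.
Proof. by move=> f g h; apply: end_alg_ext. Qed.

Fact end_mulDr : right_distributive end_mul +%R.
Proof. by move=> f g h; apply: end_alg_ext => x; apply: raddfD. Qed.

Fact end_one_neq0 : end_one != 0.
Proof.
apply/eqP => e10; have /eqP := oner_neq0 R; apply; apply: fP => x.
by rewrite scale1r; have := congr1 (@end_app ^~ x) e10.
Qed.

HB.instance Definition _ := GRing.Zmodule_isNzRing.Build (end_alg fP)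
  end_mulA end_mul1f end_mulf1 end_mulDl end_mulDr end_one_neq0.

Fact end_scaleA a b f : end_scale a (end_scale b f) = end_scale (a * b) f.
Proof. by apply: end_alg_ext => x; apply: scalerA. Qed.

Fact end_scale1 : left_id 1 end_scale.
Proof. by move=> f; apply: end_alg_ext => x; apply: scale1r. Qed.

Fact end_scaleDr : right_distributive end_scale +%R.
Proof. by move=> a f g; apply: end_alg_ext => x; apply: scalerDr. Qed.

Fact end_scaleDl f : {morph end_scale^~ f : a b / a + b}.
Proof. by move=> a b; apply: end_alg_ext => x; apply: scalerDl. Qed.

HB.instance Definition _ := GRing.Zmodule_isLmodule.Build R (end_alg fP)
  end_scaleA end_scale1 end_scaleDr end_scaleDl.

Fact end_scaleAl (a : R) f g : a *: (f * g) = a *: f * g.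
Proof. exact: end_alg_ext. Qed.

HB.instance Definition _ := GRing.Lmodule_isLalgebra.Build R (end_alg fP)
  end_scaleAl.

Fact end_scaleAr (a : R) f g : a *: (f * g) = f * (a *: g).
Proof.
by apply: end_alg_ext => x; apply/esym; apply: (linearZZ (f : {linear P -> P})).
Qed.

HB.instance Definition _ := GRing.Lalgebra_isAlgebra.Build R (end_alg fP)
  end_scaleAr.

End EndAlg.

Section Azumaya.
Variable R : comNzRingType.

Definition sandwich_fun (A : algType R) (a b : A) : A -> A :=
  fun x => a * x * b.

Fact sandwich_is_linear (A : algType R) (a b : A) : linear (sandwich_fun a b).
Proof.
by move=> r x y; rewrite /sandwich_fun mulrDr mulrDl -scalerAr -scalerAl.
Qed.

HB.instance Definition _ (A : algType R) (a b : A) :=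
  GRing.isLinear.Build R A A *:%R (sandwich_fun a b) (sandwich_is_linear a b).

Definition sandwich (A : algType R) (fA : faithful A) (a b : A) : end_alg fA :=
  sandwich_fun a b : {linear A -> A}.

(* The condition on the sandwich map (a, b) |-> (x |-> a x b) says that the
   canonical map from A \otimes_R A^op to End_R(A) is an isomorphism; A^op has
   the same underlying R-module as A. *)
Definition azumaya (A : algType R) : Prop :=
  fg_projective A /\
  exists fA : faithful A, is_tensor_product (@sandwich A fA).

(* A \otimes End_R(P) and B \otimes End_R(Q) are isomorphic R-algebras for some
   faithful finitely generated projective modules P and Q. *)
Definition brauer_equiv (A B : algType R) : Prop :=
  exists (P Q : lmodType R) (fP : faithful P) (fQ : faithful Q),
    [/\ fg_projective P, fg_projective Q &
      exists C : algType R,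
        is_tensor_algebra A (end_alg fP) C /\
        is_tensor_algebra B (end_alg fQ) C].

(* B \in [A]; for universe reasons [A] is not of type set (algType R). *)
Definition in_brauer_class (A B : algType R) : Prop :=
  azumaya B /\ brauer_equiv A B.

(* The square root of rk_R A, which is a perfect square for A Azumaya. *)
Definition deg (A : algType R) (p : prime_idealr R) : nat :=
  xget 0%N [set d | (d ^ 2)%N = rk A p].

(* Greatest common divisor of a possibly infinite set of natural numbers. *)
Definition set_gcd (S : set nat) : nat :=
  xget 0%N [set g | forall d, (d %| g)%N <-> forall n, S n -> (d %| n)%N].

Definition ind (A : algType R) (p : prime_idealr R) : nat :=
  set_gcd [set d | exists B : algType R, in_brauer_class A B /\ deg B p = d].

End Azumaya.

(* Right A-modules are left modules over A^c; such a module is an R-module by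
   restriction of scalars. *)
Definition restr (R : comNzRingType) (A : algType R) (P : lmodType A^c) : Type :=
  P.

Section Restriction.
Variables (R : comNzRingType) (A : algType R) (P : lmodType A^c).

HB.instance Definition _ := GRing.Zmodule.on (restr P).

Definition restr_scale (r : R) (x : restr P) : restr P :=
  (r%:A : A^c) *: (x : P).

Fact restr_scaleA a b x :
  restr_scale a (restr_scale b x) = restr_scale (a * b) x.
Proof.
rewrite /restr_scale scalerA; congr (_ *: _).
by rewrite -[LHS]/((b%:A : A) * a%:A) -scalerAl mul1r scalerA mulrC.
Qed.

Fact restr_scale1 : left_id 1 restr_scale.
Proof.
move=> x; rewrite /restr_scale (scale1r (1 : A)).
exact: (scale1r (x : P)).
Qed.

Fact restr_scaleDr : right_distributive restr_scale +%R.
Proof. by move=> a x y; apply: (scalerDr (a%:A : A^c) (x : P) y). Qed.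

Fact restr_scaleDl x : {morph restr_scale^~ x : a b / a + b}.
Proof.
move=> a b; rewrite /restr_scale (scalerDl (1 : A)).
exact: (scalerDl (x : P)).
Qed.

HB.instance Definition _ := GRing.Zmodule_isLmodule.Build R (restr P)
  restr_scaleA restr_scale1 restr_scaleDr restr_scaleDl.

End Restriction.

Definition rrk (R : comNzRingType) (A : algType R) (P : lmodType A^c)
    (p : prime_idealr R) : rat :=
  (rk (restr P) p)%:R / (deg A p)%:R.
Arguments rrk {R} A P p.

(* The right ideal eA, as a right A-module *)
Section RightIdeal.
Variables (R : comNzRingType) (A : algType R) (e : A).

Definition right_ideal_pred : pred A := fun x => `[< exists a, x = e * a >].

Fact right_ideal_zmod_closed : zmod_closed right_ideal_pred.
Proof.
split=> [|x y /asboolP[a ->] /asboolP[b ->]].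
  by apply/asboolP; exists 0; rewrite mulr0.
by apply/asboolP; exists (a - b); rewrite mulrBr.
Qed.

HB.instance Definition _ :=
  GRing.isZmodClosed.Build A right_ideal_pred right_ideal_zmod_closed.

Record right_ideal : Type :=
  RightIdeal { right_ideal_val :> A; _ : right_ideal_pred right_ideal_val }.

HB.instance Definition _ := [isSub for right_ideal_val].
HB.instance Definition _ := [Choice of right_ideal by <:].
HB.instance Definition _ := [SubChoice_isSubZmodule of right_ideal by <:].

Fact right_ideal_mul_subproof (a : A) (x : right_ideal) :
  right_ideal_pred (val x * a).
Proof.
by case: x => x /= /asboolP[b ->]; apply/asboolP; exists (b * a); rewrite mulrA.
Qed.

Definition right_ideal_mul (a : A^c) (x : right_ideal) : right_ideal :=
  RightIdeal (right_ideal_mul_subproof a x).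

Fact right_ideal_mulA a b x :
  right_ideal_mul a (right_ideal_mul b x) = right_ideal_mul (a * b) x.
Proof. by apply: val_inj; rewrite /= -mulrA. Qed.

Fact right_ideal_mul1 : left_id 1 right_ideal_mul.
Proof. by move=> x; apply: val_inj; rewrite /= mulr1. Qed.

Fact right_ideal_mulDr : right_distributive right_ideal_mul +%R.
Proof. by move=> a x y; apply: val_inj; rewrite /= mulrDl. Qed.

Fact right_ideal_mulDl x : {morph right_ideal_mul^~ x : a b / a + b}.
Proof. by move=> a b; apply: val_inj; rewrite /= mulrDr. Qed.

HB.instance Definition _ := GRing.Zmodule_isLmodule.Build A^c right_ideal
  right_ideal_mulA right_ideal_mul1 right_ideal_mulDr right_ideal_mulDl.

End RightIdeal.

(* The algebra eAe with unit e, for a nonzero idempotent e; algType does not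
   include the zero ring. *)
Section Corner.
Variables (R : comNzRingType) (A : algType R) (e : A).

Definition corner_pred : pred A := fun x => `[< exists a, x = e * a * e >].

Fact corner_submod_closed : submod_closed corner_pred.
Proof.
split=> [|r x y /asboolP[a ->] /asboolP[b ->]].
  by apply/asboolP; exists 0; rewrite mulr0 mul0r.
apply/asboolP; exists (r *: a + b).
by rewrite mulrDr mulrDl -scalerAr -scalerAl.
Qed.

HB.instance Definition _ :=
  GRing.isSubmodClosed.Build R A corner_pred corner_submod_closed.

Record corner (eI : e * e = e) (e_neq0 : e != 0) : Type :=
  Corner { corner_val :> A; _ : corner_pred corner_val }.

Variables (eI : e * e = e) (e_neq0 : e != 0).
Local Notation eAe := (corner eI e_neq0).

HB.instance Definition _ := [isSub for @corner_val eI e_neq0].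
HB.instance Definition _ := [Choice of eAe by <:].
HB.instance Definition _ := [SubChoice_isSubLmodule of eAe by <:].

Fact corner_one_subproof : corner_pred e.
Proof. by apply/asboolP; exists 1; rewrite mulr1 eI. Qed.

Fact corner_mul_subproof (x y : eAe) : corner_pred (val x * val y).
Proof.
case: x y => [x /= /asboolP[a ->]] [y /= /asboolP[b ->]].
by apply/asboolP; exists (a * e * (e * b)); rewrite !mulrA.
Qed.

Definition corner_one : eAe := Corner _ _ corner_one_subproof.
Definition corner_mul (x y : eAe) : eAe := Corner _ _ (corner_mul_subproof x y).

Fact corner_mulA : associative corner_mul.
Proof. by move=> x y z; apply: val_inj; rewrite /= mulrA. Qed.

Fact corner_mul1x : left_id corner_one corner_mul.
Proof.
by case=> x xP; apply: val_inj => /=; case/asboolP: xP => a ->; rewrite !mulrA eI.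
Qed.

Fact corner_mulx1 : right_id corner_one corner_mul.
Proof.
by case=> x xP; apply: val_inj => /=; case/asboolP: xP => a ->; rewrite -!mulrA eI.
Qed.

Fact corner_mulDl : left_distributive corner_mul +%R.
Proof. by move=> x y z; apply: val_inj; rewrite /= mulrDl. Qed.

Fact corner_mulDr : right_distributive corner_mul +%R.
Proof. by move=> x y z; apply: val_inj; rewrite /= mulrDr. Qed.

Fact corner_one_neq0 : corner_one != 0.
Proof. by rewrite -val_eqE. Qed.

HB.instance Definition _ := GRing.Zmodule_isNzRing.Build eAe
  corner_mulA corner_mul1x corner_mulx1 corner_mulDl corner_mulDr
  corner_one_neq0.

Fact corner_scaleAl (r : R) (x y : eAe) : r *: (x * y) = r *: x * y.
Proof. by apply: val_inj; rewrite /= scalerAl. Qed.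

HB.instance Definition _ := GRing.Lmodule_isLalgebra.Build R eAe corner_scaleAl.

Fact corner_scaleAr (r : R) (x y : eAe) : r *: (x * y) = x * (r *: y).
Proof. by apply: val_inj; rewrite /= scalerAr. Qed.

HB.instance Definition _ := GRing.Lalgebra_isAlgebra.Build R eAe corner_scaleAr.

End Corner.

(* Main.v *)
Require Import Defs.
From HB Require Import structures.
From mathcomp Require Import all_boot all_order all_algebra.
From mathcomp Require Import generic_quotient ring_quotient fraction falgebra.
From mathcomp Require Import boolp classical_sets cardinality.

(* At each maximal ideal m of R the algebra A/mA is a matrix algebra over a
   division algebra of square dimension, so two idempotents of A are comparable
   modulo m according to the ranks at m of the right ideals they generate. By
   the Chinese remainder theorem and Nakayama's lemma, pointwise comparison of
   ranks at the finitely many maximal ideals already yields comparison in A, and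
   Goldman's idempotents split R according to the ranks. Euclidean division of
   ranks therefore shows that, for a minimal idempotent e that is nonzero modulo
   every maximal ideal, each right ideal gA with g idempotent is a direct
   sum of modules f_i eA with f_i idempotent in R. Taking g = 1 makes eAe Brauer
   equivalent to A. If A (x) End P = C = B (x) End Q, rank one idempotents of
   End P and End Q make A and B corners of C; e stays minimal in C, and
   decomposing the idempotent of C that cuts out B gives deg eAe | deg B. *)

Set Implicit Arguments.
Unset Strict Implicit.
Unset Printing Implicit Defensive.

Import GRing.Theory.
Local Open Scope ring_scope.
Local Open Scope quotient_scope.

(** * Prime and maximal ideals *)

(** Spec R need not be connected, so a primitive idempotent of A is of no use: it may vanish at some
    maximal ideals. This is why e is minimal only among idempotents that are nonzero at every
    maximal ideal, and why idempotents f_i of R appear in the decompositions. Of the Azumaya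
    condition, only the surjectivity of A (x) A^op -> End_R(A) is carried to A / mA and to C. It
    transfers by explicit formulas, and over a field it already forces simplicity and the square
    dimension of the division algebra; the latter is obtained by counting dimensions over a maximal
    subfield, without a splitting field. Semilocality is used for gluing over the maximal ideals,
    for the finite sum of local ranks that is minimised, and for splitting a copy of R off P and Q.
    An arbitrary prime is treated through a maximal ideal above it. *)

Lemma fraction_mulV (T : idomainType) (n d : T) : d != 0 ->
  \pi_{fraction T} (Ratio n d) * FracField.tofrac d = FracField.tofrac n.
Proof.
move=> d0; rewrite !piE; apply/eqP;
  rewrite FracField.equivf_def /FracField.mulf.
by rewrite !numden_Ratio ?mulf_neq0 ?oner_neq0 // !mulr1 mulrC.
Qed.

Section ResidueField.
Variables (R : comNzRingType) (p : prime_idealr R).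

(** R / p. Forming its fraction field requires an [idomainType], which includes a boolean unit
    predicate and an inverse; both are supplied below by classical choice. *)
Definition prime_quot : Type := {ideal_quot p}.
HB.instance Definition _ := GRing.ComNzRing.on prime_quot.

Definition prime_quot_unit : pred prime_quot :=
  fun x => `[< exists y, y * x = 1 >].
Definition prime_quot_inv (x : prime_quot) : prime_quot :=
  if pselect (exists y, y * x = 1) is left ex then projT1 (cid ex) else x.

Fact prime_quot_mulVx : {in prime_quot_unit, left_inverse 1 prime_quot_inv *%R}.
Proof.
move=> x /asboolP ux; rewrite /prime_quot_inv; case: pselect => // ex.
exact: projT2 (cid ex).
Qed.

Fact prime_quot_unitPl (x y : prime_quot) : y * x = 1 -> prime_quot_unit x.
Proof. by move=> yx1; apply/asboolP; exists y. Qed.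

Fact prime_quot_invx_out : {in [predC prime_quot_unit], prime_quot_inv =1 id}.
Proof.
move=> x /negP ux; rewrite /prime_quot_inv; case: pselect => // ex.
by case: ux; apply/asboolP.
Qed.

HB.instance Definition _ := GRing.ComNzRing_hasMulInverse.Build prime_quot
  prime_quot_mulVx prime_quot_unitPl prime_quot_invx_out.

Fact prime_quot_integral (x y : prime_quot) :
  x * y = 0 -> (x == 0) || (y == 0).
Proof. exact: Quotient.rquot_IdomainAxiom. Qed.

HB.instance Definition _ :=
  GRing.ComUnitRing_isIntegral.Build prime_quot prime_quot_integral.

Definition residue_field : fieldType := {fraction prime_quot}.

Definition residue (x : R) : residue_field :=
  @FracField.tofrac prime_quot (\pi_{ideal_quot p} x).

Fact residue_zmod_morphism : zmod_morphism residue.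
Proof.
move=> x y; rewrite /residue -rmorphB; congr (FracField.tofrac _).
exact: (rmorphB (\pi_{ideal_quot p})).
Qed.
Fact residue_monoid_morphism : monoid_morphism residue.
Proof.
rewrite /residue; split=> [|x y].
  have -> : \pi_{ideal_quot p} 1 = 1 :> prime_quot by exact: (rmorph1
    (\pi_{ideal_quot p})).
  exact: rmorph1.
rewrite -rmorphM; congr (FracField.tofrac _).
exact: (rmorphM (\pi_{ideal_quot p})).
Qed.

HB.instance Definition _ :=
  GRing.isZmodMorphism.Build R residue_field residue residue_zmod_morphism.
HB.instance Definition _ :=
  GRing.isMonoidMorphism.Build R residue_field residue residue_monoid_morphism.

Lemma residueM x y : residue (x * y) = residue x * residue y.
Proof. exact: rmorphM. Qed.

Lemma residueB x y : residue (x - y) = residue x - residue y.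
Proof. exact: rmorphB. Qed.

Lemma residue_sum (I : Type) (r : seq I) (P : pred I) (F : I -> R) :
  residue (\sum_(i <- r | P i) F i) = \sum_(i <- r | P i) residue (F i).
Proof. exact: rmorph_sum. Qed.

Lemma residue_prod (I : Type) (r : seq I) (P : pred I) (F : I -> R) :
  residue (\prod_(i <- r | P i) F i) = \prod_(i <- r | P i) residue (F i).
Proof. exact: rmorph_prod. Qed.

Lemma residue_eq0 x : (residue x == 0) = (x \in p).
Proof.
rewrite /residue tofrac_eq0.
have -> : (0 : prime_quot) = \pi_{ideal_quot p} 0.
  by rewrite (rmorph0 (\pi_{ideal_quot p})).
by rewrite -[X in _ = X](congr1 (fun u => u \in p) (subr0 x)) Quotient.idealrBE.
Qed.

Lemma residue_frac (k : residue_field) :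
  exists x s, s \notin p /\ k = residue x / residue s.
Proof.
elim/quotW: k => r.
have [n [d [dn0 ->]]] : exists n d : prime_quot, d != 0 /\ r = Ratio n d.
  by exists (\n_r), (\d_r); rewrite denom_ratioP Ratio_numden.
exists (repr n), (repr d).
have dp : repr d \notin p.
  by rewrite -residue_eq0 /residue reprK tofrac_eq0.
split=> //; have rd0 : residue (repr d) != 0 by rewrite residue_eq0.
apply: (mulIf rd0); rewrite mulfVK // /residue !reprK; exact: fraction_mulV.
Qed.

End ResidueField.

Section MaximalIdeals.
Variable R : comNzRingType.
Implicit Types (m p : prime_idealr R).

(** If 1 were not in m + Rx, this set would be a proper ideal containing m, hence contained in m by
    maximality, although it contains x. *)
Lemma maximal_ideal_inv (m : pred R) x : maximal_ideal m -> x \notin m ->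
  exists2 y, y \in m & exists r, y + r * x = 1.
Proof.
move=> [[m0 m1 mMl] mM] xm; apply: contrapT => H.
pose I : pred R := fun z => `[< exists2 y, y \in m & exists r, z = y + r * x >].
have mI : {subset m <= I}.
  by move=> y ym; apply/asboolP; exists y => //; exists 0; rewrite mul0r addr0.
have II : idealr_closed I.
  split; first exact: mI.
    apply/negP => /asboolP[y ym [r e]]; apply: H.
    by exists y => //; exists r.
  move=> a u v /asboolP[y ym [r ->]] /asboolP[z zm [s ->]].
  apply/asboolP; exists (a * y + z); first exact: mMl.
  by exists (a * r + s); rewrite mulrDr mulrDl mulrA addrACA.
have /(mM I II mI) : x \in I.
  by apply/asboolP; exists 0 => //; exists 1; rewrite add0r mul1r.
exact/negP.
Qed.

Lemma maximal_ideal_prime (m : pred R) :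
  maximal_ideal m -> exists p : prime_idealr R, (p : pred R) = m.
Proof.
move=> mmax; have [mI mM] := mmax; have [m0 m1 mMl] := mI.
have mMr a u : u \in m -> a * u \in m by move=> um; rewrite -[_ * _]addr0 mMl.
have mP : prime_idealr_closed m.
  move=> x y xym; apply: contrapT => /negP; rewrite negb_or => /andP[xm ym].
  have [u um [r ur1]] := maximal_ideal_inv mmax xm.
  move/negP: ym; apply; rewrite -[y]mul1r -ur1 mulrDl mulrC.
  by apply: mMl => //; rewrite -mulrA mMr.
pose mi : prime_idealr R := HB.pack m (isIdealr.Build R m mI)
  (isPrimeIdealrClosed.Build R m mP).
by exists mi.
Qed.

Lemma maximal_ideal_above (I : pred R) : idealr_closed I ->
  exists m : pred R, maximal_ideal m /\ {subset I <= m}.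
Proof.
move=> II.
pose T := {J : pred R | idealr_closed J /\ {subset I <= J}}.
pose le (J K : T) := `[< {subset sval J <= sval K} >].
have [||C Ctot|[M [MI IM]] /= Mmax] :=
    @ZL_preorder T (exist _ I (conj II (fun _ => id))) le.
- by move=> J; apply/asboolP.
- by move=> K J L /asboolP KJ /asboolP JL; apply/asboolP => x /KJ/JL.
(* The empty chain is bounded by I itself. For a nonempty chain the union is proper because 1 lies
   in no member. *)
- have [[J0 CJ0]|C0] := pselect (exists J, C J); last first.
    exists (exist _ I (conj II (fun _ => id))) => J CJ.
    by case: C0; exists J.
  pose U : pred R := fun x => `[< exists2 J, C J & x \in sval J >].
  have UI : idealr_closed U.
    split.
    - by apply/asboolP; exists J0 => //; have [[]] := svalP J0.
    - apply/negP => /asboolP[J CJ J1]; have [[_ /negP + _] _] := svalP J.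
      exact.
    - move=> a u v /asboolP[J CJ uJ] /asboolP[K CK vK]; apply/asboolP.
      have [[_ _ JM] _] := svalP J; have [[_ _ KM] _] := svalP K.
      have [/asboolP JK|/asboolP KJ] := Ctot J K CJ CK.
        by exists K => //; apply: KM => //; apply: JK.
      by exists J => //; apply: JM => //; apply: KJ.
  have IU : {subset I <= U}.
    by move=> x xI; apply/asboolP; exists J0 => //; have [_] := svalP J0; apply.
  exists (exist _ U (conj UI IU)) => J CJ; apply/asboolP => x xJ.
  by apply/asboolP; exists J.
exists M; split=> //; split=> // J JI MJ.
have IJ : {subset I <= J} by move=> x /IM/MJ.
have := Mmax (exist _ J (conj JI IJ)); rewrite /le /=.
by move/(_ (asboolT MJ))/asboolP.
Qed.

Definition maximal m := maximal_ideal (m : pred R).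

Lemma maximal_above (I : pred R) : idealr_closed I ->
  exists2 m, maximal m & {subset I <= m}.
Proof.
move=> /maximal_ideal_above[J [Jmax IJ]].
by have [m eq_m] := maximal_ideal_prime Jmax; exists m; rewrite /maximal eq_m.
Qed.

Lemma prime_idealr_closedP p : idealr_closed (p : pred R).
Proof.
split; rewrite ?idealr0 ?idealr1 // => a u v up vp.
by rewrite rpredD // idealMr.
Qed.

Lemma unit_outside_maximal x :
  (forall m, maximal m -> x \notin m) -> exists y, y * x = 1.
Proof.
move=> xm; apply: contrapT => nunit.
pose I : pred R := fun z => `[< exists r, z = r * x >].
have [] // := @maximal_above I.
  split.
  - by apply/asboolP; exists 0; rewrite mul0r.
  - by apply/negP => /asboolP[y y1]; apply: nunit; exists y.
  - move=> a u v /asboolP[r ->] /asboolP[s ->]; apply/asboolP;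
    exists (a * r + s).
    by rewrite mulrDl mulrA.
move=> m /xm /negP mx Im; apply: mx; apply: Im; apply/asboolP.
by exists 1; rewrite mul1r.
Qed.

Lemma residue_eq p x y : (residue p x == residue p y) = (x - y \in p).
Proof. by rewrite -subr_eq0 -residueB residue_eq0. Qed.

(** For s outside m some r satisfies r s = 1 modulo m, so every fraction with denominator s is
    already a residue: the fraction field of R / m is R / m. *)
Lemma residue_surj m : maximal m -> forall k, exists x, residue m x = k.
Proof.
move=> mmax k; have [x [s [sm ->]]] := residue_frac k.
have [y ym [r yr1]] := maximal_ideal_inv mmax sm.
exists (r * x); have s0 : residue m s != 0 by rewrite residue_eq0.
apply: (mulIf s0); rewrite mulfVK // -residueM; apply/eqP.
rewrite residue_eq mulrAC -[X in _ - X]mul1r -mulrBl -yr1 opprD addrC.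
by rewrite addrNK mulNr rpredN mulrC idealMr.
Qed.

Lemma eq_ideal_mem (p q : prime_idealr R) :
  (p : pred R) = q -> forall x, (x \in p) = (x \in q).
Proof. by move=> pq x; rewrite -[LHS]/((p : pred R) x) pq. Qed.

Lemma maximal_not_sub (m m' : prime_idealr R) : maximal m -> maximal m' ->
  (m : pred R) <> m' -> exists2 x, x \in m' & x \notin m.
Proof.
move=> mmax m'max mm'; apply: contrapT => H; apply: mm'.
have sub : {subset m' <= m}.
  move=> x xm'; apply: contrapT => /negP xm.
  by apply: H; exists x.
have [_ M] := m'max; have {}M := M _ (prime_idealr_closedP m) sub.
apply/funext => x; apply/idP/idP => xm; [exact: M|exact: sub].
Qed.

End MaximalIdeals.

(** Semilocality as data, an enumeration without repetition, so that elements can be glued by sums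
    over ['I_nmax]. Ideals are compared as predicates, since a [prime_idealr R] also carries
    structure. *)
Record maximal_spectrum (R : comNzRingType) := MaximalSpectrum {
  nmax : nat;
  max_ideal : 'I_nmax -> prime_idealr R;
  max_idealP : forall i, maximal (max_ideal i);
  max_ideal_inj : forall i j, (max_ideal i : pred R) = max_ideal j -> i = j;
  max_ideal_onto :
    forall m : prime_idealr R, maximal m ->
      exists i, (max_ideal i : pred R) = m }.

Lemma semilocal_spectrum (R : comNzRingType) :
  semilocal R -> inhabited (maximal_spectrum R).
Proof.
move=> /(@finite_seqP {classic pred R})[s sE].
have sP (p : {classic pred R}) : (p \in undup s) <-> maximal_ideal p.
  by rewrite mem_undup; split=> H; have := congr1 (@^~ p) sE;
    rewrite /= => /propeqP []; auto.
have mP (i : 'I_(size (undup s))) : maximal_ideal (nth (pred0 : {classic pred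
  R}) (undup s) i).
  by apply/sP; rewrite mem_nth.
pose f i := projT1 (cid (maximal_ideal_prime (mP i))).
have fE i : (f i : pred R) = nth (pred0 : {classic pred R}) (undup s) i.
  exact: projT2 (cid (maximal_ideal_prime (mP i))).
constructor; apply: (@MaximalSpectrum R _ f) => [i|i j|m mmax].
- by rewrite /maximal fE; apply: mP.
- rewrite !fE => /eqP; rewrite (nth_uniq (pred0 : {classic pred R}))
  ?undup_uniq //.
  by move=> /eqP /val_inj.
- have ms : (m : pred R) \in undup s by apply/sP.
  have := ms; rewrite -index_mem => lt_i; exists (Ordinal lt_i).
  by rewrite fE /= nth_index.
Qed.

Section CRT.
Variables (R : comNzRingType) (S : maximal_spectrum R).
Local Notation n := (nmax S).
Local Notation m := (@max_ideal R S).

Lemma max_above (p : prime_idealr R) : exists i, {subset p <= m i}.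
Proof.
have [q qmax pq] := maximal_above (prime_idealr_closedP p).
have [i iE] := max_ideal_onto S qmax; exists i => x /pq.
by rewrite (eq_ideal_mem iE).
Qed.

Lemma unit_mod_max x : (forall i, x \notin m i) -> exists y, y * x = 1.
Proof.
move=> xm; apply: unit_outside_maximal => q qmax.
have [i iE] := max_ideal_onto S qmax.
by rewrite -(eq_ideal_mem iE).
Qed.

(** For each j different from i pick an element of the j-th ideal outside the i-th one. Their
    product vanishes at all j and is nonzero at i, where it is rescaled to 1. *)
Lemma chinese_unit (i : 'I_n) : exists c : R,
  residue (m i) c = 1 /\ forall j, j != i -> residue (m j) c = 0.
Proof.
have H (j : 'I_n) : {x : R | j != i -> x \in m j /\ x \notin m i}.
  apply: cid; have [->|ji] := eqVneq j i; first by exists 0.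
  have [|x xj xi] := @maximal_not_sub R (m i) (m j) (max_idealP i) (max_idealP
    j).
    by move=> /max_ideal_inj /esym /eqP; rewrite (negPf ji).
  by exists x.
pose y := \prod_(j | j != i) sval (H j).
have yi : residue (m i) y != 0.
  rewrite residue_prod prodf_seq_neq0; apply/allP => j _; apply/implyP => ji.
  by rewrite residue_eq0; have [] := svalP (H j) ji.
have [z zE] := residue_surj (max_idealP i) (residue (m i) y)^-1.
exists (z * y); rewrite residueM zE mulVf //; split=> // j ji.
rewrite residueM residue_prod (bigD1 j) //=.
suff -> : residue (m j) (sval (H j)) = 0 by rewrite mul0r mulr0.
by apply/eqP; rewrite residue_eq0; have [] := svalP (H j) ji.
Qed.

Lemma chinese : exists c : 'I_n -> R,
  forall i j, residue (m i) (c j) = (i == j)%:R.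
Proof.
exists (fun i => sval (cid (chinese_unit i))) => i j.
case: cid => c /= [c1 c0]; have [->|ij] := eqVneq i j; first by rewrite c1.
by rewrite c0.
Qed.

End CRT.

(** * Ranks and Goldman idempotents *)

Notation residue_mx p := (map_mx (residue p)).

Section LocalRank.
Variables (R : comNzRingType) (p : prime_idealr R).
Local Notation res := (residue p).

Lemma notin_prod (I : finType) (P : pred I) (s : I -> R) :
  (forall j, P j -> s j \notin p) -> \prod_(j | P j) s j \notin p.
Proof.
move=> sp; rewrite -residue_eq0 residue_prod prodf_seq_neq0.
by apply/allP => j _; apply/implyP => /sp; rewrite residue_eq0.
Qed.

Lemma common_denominator (I : finType) (s : I -> R) :
  (forall j, s j \notin p) ->
  exists s0 (t : I -> R), s0 \notin p /\ forall j, s0 = t j * s j.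
Proof.
move=> sp; exists (\prod_j s j), (fun j => \prod_(k | k != j) s k).
split; first exact: notin_prod.
by move=> j; rewrite (bigD1 j) //= mulrC.
Qed.

Lemma clear_denominators m n (Y : 'M[residue_field p]_(m, n)) :
  exists s (Z : 'M[R]_(m, n)), s \notin p /\ residue_mx p Z = res s *: Y.
Proof.
have /fin_all_exists[xs xsP] (ij : 'I_m * 'I_n) : exists xs : R * R,
    xs.2 \notin p /\ Y ij.1 ij.2 = res xs.1 / res xs.2.
  by have [x [s [? ?]]] := residue_frac (Y ij.1 ij.2); exists (x, s).
have [s [t [sp st]]] :=
  @common_denominator _ (fun ij => (xs ij).2) (fun ij => (xsP ij).1).
exists s, (\matrix_(i, j) (t (i, j) * (xs (i, j)).1)); split=> //.
apply/matrixP => i j; rewrite !mxE (xsP (i, j)).2 residueM (st (i, j)).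
rewrite residueM -mulrA; congr (_ * _); rewrite mulrC divfK //.
by rewrite residue_eq0 (xsP (i, j)).1.
Qed.

Lemma residue_det n (A : 'M[R]_n) : res (\det A) = \det (residue_mx p A).
Proof. by rewrite det_map_mx. Qed.

Lemma det_notin n (A : 'M[R]_n) s : s \notin p -> residue_mx p A = (res s)%:M ->
  \det A \notin p.
Proof.
by move=> sp AE; rewrite -residue_eq0 residue_det AE det_scalar expf_neq0
  ?residue_eq0.
Qed.

Variables (M : lmodType R) (n : nat).
Variables (i : {linear M -> 'rV[R]_n}) (r : {linear 'rV[R]_n -> M}).
Hypothesis iK : cancel i r.
Local Notation pi := (lin1_mx (i \o r)).

Lemma coord_mul (x : M) : i x *m pi = i x.
Proof. by rewrite mul_rV_lin1 /= iK. Qed.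

Lemma coord_sum (x : M) : x = \sum_j i x 0 j *: r (delta_mx 0 j).
Proof.
rewrite -[LHS]iK {1}[i x]row_sum_delta linear_sum; apply: eq_bigr => j _.
by rewrite linearZ.
Qed.

Lemma row_coord j : row j pi = i (r (delta_mx 0 j)).
Proof. by rewrite rowE mul_rV_lin1. Qed.

(** Generation gives [s *: pi = C *m X], where the rows of X are the x_a, and freeness gives X C = s
    over the residue field. So the rows of X are independent there and span the row space of pi. *)
Lemma local_basis_size k (x : 'I_k -> M) :
  local_basis p x -> k = \rank (residue_mx p pi).
Proof.
move=> [gen free].
have /fin_all_exists[g /fin_all_exists[c gP]] j := gen (r (delta_mx 0 j)).
have [s [t [sp st]]] := common_denominator (fun j => (gP j).1).
pose C := \matrix_(j, a) (t j * c j a).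
pose X := \matrix_a i (x a).
have sC j : s *: r (delta_mx 0 j) = \sum_a C j a *: x a.
  rewrite (st j) -scalerA (gP j).2 scaler_sumr; apply: eq_bigr => a _.
  by rewrite mxE scalerA.
have spi : s *: pi = C *m X.
  apply/row_matrixP => j; rewrite linearZ /= row_coord row_mul -linearZ /= sC.
  rewrite linear_sum /= mulmx_sum_row; apply: eq_bigr => a _.
  by rewrite linearZ /= rowK !mxE.
have Xpi : X *m pi = X.
  by apply/row_matrixP => a; rewrite row_mul rowK coord_mul.
(* The entries of a row of X C - s are the coefficients of a relation among the x_b, so freeness
   kills each of them by an element outside p. *)
have XC : residue_mx p (X *m C) = (res s)%:M.
  apply/matrixP => a b; rewrite [LHS]mxE [RHS]mxE -(rmorphMn res).
  apply/eqP; rewrite residue_eq.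
  pose c' b := (X *m C) a b - s *+ (a == b).
  have /free/(_ b)[u up uc] : \sum_b c' b *: x b = 0.
    under eq_bigr do rewrite scalerBl.
    rewrite sumrB [X in _ - X](bigD1 a) //= eqxx [X in _ - (_ + X)]big1 ?addr0;
      last first.
      by move=> j ja; rewrite eq_sym (negPf ja) mulr0n scale0r.
    rewrite mulr1n; apply/eqP; rewrite subr_eq0; apply/eqP.
    rewrite [in RHS](coord_sum (x a)) scaler_sumr.
    under eq_bigr do rewrite mxE scaler_suml.
    rewrite exchange_big; apply: eq_bigr => j _ /=.
    rewrite scalerA mulrC -scalerA sC scaler_sumr; apply: eq_bigr => b' _.
    by rewrite scalerA !mxE.
  have : u * c' b \in p by rewrite uc rpred0.
  by rewrite prime_idealrM (negPf up).
have s0 : res s != 0 by rewrite residue_eq0.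
have freeX : row_free (residue_mx p X).
  apply/row_freeP; exists ((res s)^-1 *: residue_mx p C).
  by rewrite -scalemxAr -map_mxM XC scale_scalar_mx mulVf.
rewrite -(eqnP freeX); apply/eqP; rewrite eqn_leq !mxrankS //.
  have -> : residue_mx p pi = (res s)^-1 *: (residue_mx p C *m residue_mx p X).
    by rewrite -map_mxM -spi map_mxZ scalerA mulVf ?scale1r.
  by rewrite scalemx_sub // submxMl.
by rewrite -Xpi map_mxM submxMl.
Qed.

(* Nakayama's lemma in determinant form: rows of pi spanning its row space over
   the residue field span it over R up to a determinant outside p. *)
Lemma local_basis_exists :
  exists x : 'I_(\rank (residue_mx p pi)) -> M, local_basis p x.
Proof.
pose Pi := residue_mx p pi; pose f := maxrankfun Pi.
pose x a := r (delta_mx 0 (f a)); exists x.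
pose X : 'M[R]_(\rank Pi, n) := rowsub f pi.
have rowX a : row a X = i (x a) by rewrite row_rowsub row_coord.
have resX : residue_mx p X = rowsub f Pi by apply/matrixP => a b; rewrite !mxE.
have freeX : row_free (residue_mx p X) by rewrite resX maxrowsub_free.
have Xpi : X *m pi = X.
  by apply/row_matrixP => a; rewrite row_mul rowX coord_mul.
have [s [C [sp CE]]] := clear_denominators (Pi *m pinvmx (residue_mx p X)).
have [s' [D [s'p DE]]] := clear_denominators (pinvmx (residue_mx p X)).
split.
  pose Z := s *: pi - C *m X.
  have resZ : residue_mx p Z = 0.
    rewrite /Z map_mxB map_mxZ map_mxM CE -scalemxAl mulmxKpV ?subrr //.
    by rewrite resX eq_maxrowsub.
  have pipi : pi *m pi = pi.
    by apply/row_matrixP => j; rewrite row_mul row_coord coord_mul.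
  have Zpi : Z *m pi = Z.
    by rewrite mulmxBl -scalemxAl pipi -mulmxA Xpi.
  (* Z vanishes over the residue field, so [\det Y] lies outside p. Multiplying [Y *m pi = C *m X]
     by the adjugate expresses [\det Y *: pi] through the rows of X. *)
  pose Y := s%:M - Z.
  have Ypi : Y *m pi = C *m X.
    by rewrite mulmxBl mul_scalar_mx Zpi opprB addrCA subrr addr0.
  have dY : \det Y *: pi = \adj Y *m C *m X.
    by rewrite -mulmxA -Ypi mulmxA mul_adj_mx mul_scalar_mx.
  move=> m; exists (\det Y), (fun a => (i m *m \adj Y *m C) 0 a); split.
    apply: (det_notin sp); rewrite map_mxB resZ subr0.
    by rewrite map_scalar_mx.
  apply: (can_inj iK); rewrite linearZ /= -{1}coord_mul scalemxAr dY.
  rewrite linear_sum /= 2!mulmxA mulmx_sum_row; apply: eq_bigr => a _.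
  by rewrite linearZ rowX.
(* D is a right inverse of X over the residue field up to the factor s', so this determinant is
   outside p. A relation c satisfies c X = 0 and is killed by it through the adjugate. *)
move=> c c0; suff vdet : \det (X *m D) *: \row_a c a = 0.
  move=> a; exists (\det (X *m D)); last first.
    by have := congr1 (fun v : 'rV_(_) => v 0 a) vdet; rewrite !mxE.
  apply: (det_notin s'p); rewrite map_mxM DE -scalemxAr mulmxVp //.
  by rewrite scalemx1.
rewrite -mul_mx_scalar -mul_mx_adj !mulmxA [_ *m X]mulmx_sum_row.
under eq_bigr do rewrite rowX mxE -linearZ /=.
by rewrite -linear_sum c0 linear0 !mul0mx.
Qed.

Lemma rkE : rk M p = \rank (residue_mx p pi).
Proof.
have [x xP] := local_basis_exists.
rewrite /rk; case: xgetP => [k kE [y]|/(_ _) H]; first exact: local_basis_size.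
by case: (H (\rank (residue_mx p pi))); exists x.
Qed.

End LocalRank.

(** Denominators outside q are outside p, so a local basis at q is also one at p. *)
Lemma rk_prime_sub (R : comNzRingType) (p q : prime_idealr R) (M : lmodType R) :
  fg_projective M -> {subset p <= q} -> rk M p = rk M q.
Proof.
move=> [n [i [r iK]]] pq; have npq s : s \notin q -> s \notin p.
  by apply: contra; apply: pq.
rewrite (rkE q iK) (rkE p iK).
have [x [gen free]] := local_basis_exists q iK.
apply/esym/(@local_basis_size _ p _ _ _ _ iK _ x); split.
  by move=> m; have [s [c [/npq ? ?]]] := gen m; exists s, c.
by move=> c /free + a => /(_ a)[t /npq]; exists t.
Qed.

(** Sylvester's identity: one block matrix is factored into block triangular matrices in two
    ways. *)
Lemma det_1D_mulC (R : comNzRingType) m n (A : 'M[R]_(m, n)) (B : 'M[R]_(n, m))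
  :
  \det (1%:M + A *m B) = \det (1%:M + B *m A).
Proof.
have e1 : block_mx 1%:M (- A) B 1%:M =
    block_mx 1%:M 0 B 1%:M *m block_mx 1%:M (- A) 0 (1%:M + B *m A).
  rewrite mulmx_block ?(mul1mx, mulmx1, mul0mx, mulmx0, addr0, add0r).
  by rewrite mulmxN addrC addrK.
have e2 : block_mx 1%:M (- A) B 1%:M =
    block_mx 1%:M (- A) 0 1%:M *m block_mx (1%:M + A *m B) 0 B 1%:M.
  rewrite mulmx_block ?(mul1mx, mulmx1, mul0mx, mulmx0, addr0, add0r).
  by rewrite mulNmx addrK.
have := congr1 determinant e1; rewrite e2 !det_mulmx.
by rewrite det_lblock !det_ublock det_lblock !det1 !mul1r !mulr1.
Qed.

Section RankIdempotents.
Variables (R : comNzRingType) (n : nat) (P : 'M[R]_n).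

(* Goldman's polynomial det (1 - P + P X): on a component of Spec R where the
   idempotent matrix P has rank k it is X^k. *)
Definition rank_poly : {poly R} :=
  \det (1%:M + ('X - 1) *: map_mx polyC P).

Lemma rank_poly_horner (S : comNzRingType) (f : {rmorphism R -> S}) (z : S) :
  (map_poly f rank_poly).[z] = \det (1%:M + (z - 1) *: map_mx f P).
Proof.
pose g : {rmorphism {poly R} -> S} := horner_eval z \o map_poly f.
rewrite -[LHS]/(g rank_poly) -det_map_mx; congr (\det _).
rewrite map_mxD map_mx1 map_mxZ -map_mx_comp rmorphB rmorph1.
congr (_ + (_ - _) *: _); [by rewrite /g /= map_polyX /horner_eval hornerX |
  exact: rmorph1 |].
by apply/matrixP => a b; rewrite !mxE /= map_polyC /horner_eval hornerC.
Qed.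

Hypothesis PP : P *m P = P.

(** For idempotent P one has (1 - P + zP)(1 - P + wP) = 1 - P + zwP; take determinants. *)
Lemma rank_poly_horner_mul (S : comNzRingType) (f : {rmorphism R ->
  S}) (z w : S) :
  (map_poly f rank_poly).[z * w] =
    (map_poly f rank_poly).[z] * (map_poly f rank_poly).[w].
Proof.
rewrite !rank_poly_horner -det_mulmx; congr (\det _).
rewrite mulmxDl mul1mx mulmxDr mulmx1 -scalemxAl -scalemxAr -map_mxM PP scalerA.
rewrite -addrA -!scalerDl; congr (_ + _ *: _).
by rewrite -{1}[z - 1]mulr1 -mulrDr [1 + _]addrC subrK mulrBl mul1r [RHS]addrC
  addrA subrK.
Qed.

(** Evaluate the multiplicativity at two independent indeterminates and compare the coefficients of
    their monomials of bidegree (j, k): a polynomial in the product of the two has only diagonal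
    terms. *)
Lemma rank_poly_orthogonal j k :
  rank_poly`_j * rank_poly`_k = rank_poly`_j *+ (j == k).
Proof.
pose f : {rmorphism R -> {poly {poly R}}} := polyC \o polyC.
have h z : (map_poly f rank_poly).[z] =
    \sum_(i < size rank_poly) (rank_poly`_i)%:P%:P * z ^+ i.
  rewrite (horner_coef_wide _ (size_poly _ _)); apply: eq_bigr => i _.
  by rewrite coef_map.
have := rank_poly_horner_mul f 'X ('X%:P).
have -> : (map_poly f rank_poly).['X] = map_poly polyC rank_poly.
  rewrite h /map_poly poly_def; apply: eq_bigr => i _.
  by rewrite mul_polyC.
have -> : (map_poly f rank_poly).['X%:P] = rank_poly%:P.
  rewrite h -[in RHS](coefK rank_poly) poly_def rmorph_sum;
    apply: eq_bigr => i _.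
  by rewrite -mul_polyC rmorphM rmorphXn.
move/(congr1 (fun q : {poly {poly R}} => q`_j`_k)).
rewrite coefMC coef_map /= coefCM => <-; rewrite h.
have -> : \sum_(i < size rank_poly) (rank_poly`_i)%:P%:P * ('X * 'X%:P) ^+ i =
    \poly_(i < size rank_poly) (rank_poly`_i *: 'X^i) :> {poly {poly R}}.
  rewrite poly_def; apply: eq_bigr => i _.
  by rewrite exprMn mulrCA mulrC -[RHS]mul_polyC -(mul_polyC (rank_poly`_i))
    polyCM rmorphXn.
rewrite coef_poly; case: ltnP => [_|/leq_sizeP->] //;
  last by rewrite mul0rn coef0.
by rewrite coefZ coefXn mulr_natr [k == j]eq_sym.
Qed.

End RankIdempotents.

(** Over a field an idempotent factors as [col_base Q *m row_base Q] with the reversed product equal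
    to 1. Sylvester's identity then reduces the determinant to that of the scalar matrix X of size
    [\rank Q]. *)
Lemma rank_poly_residue (R : comNzRingType) n (P : 'M[R]_n) (p : prime_idealr
  R) k :
  P *m P = P ->
  residue p (rank_poly P)`_k = (k == \rank (residue_mx p P))%:R.
Proof.
move=> PP; set Q := residue_mx p P.
have QQ : Q *m Q = Q by rewrite -map_mxM PP.
have cb : row_base Q *m col_base Q = 1%:M.
  have e : col_base Q *m (row_base Q *m col_base Q *m row_base Q) =
      col_base Q *m row_base Q.
    by rewrite -(mulmxA (row_base Q)) mulmxA !mulmx_base.
  have {}e := row_full_inj (col_base_full Q) e.
  by apply: (row_free_inj (row_base_free Q)); rewrite mul1mx e.
have E : map_poly (residue p) (rank_poly P) = 'X^(\rank Q).
  rewrite /rank_poly -det_map_mx map_mxD map_mx1 map_mxZ -map_mx_comp.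
  have -> : map_mx (map_poly (residue p) \o polyC) P = map_mx polyC Q.
    by apply/matrixP => a b; rewrite !mxE /= map_polyC.
  rewrite rmorphB /= map_polyX (rmorph1 (map_poly _)) -{1}(mulmx_base Q)
    map_mxM scalemxAl.
  rewrite det_1D_mulC -scalemxAr -map_mxM cb map_mx1 scalemx1.
  by rewrite -raddfD /= [1 + _]addrC subrK det_scalar.
by have := congr1 (fun q : {poly _} => q`_k) E; rewrite coef_map coefXn.
Qed.

(** * Central simple algebras over a field *)

Section LinearMaps.
Variables (R : nzRingType) (U V : lmodType R) (f : U -> V).

Definition to_linear (fl : linear f) : {linear U -> V} :=
  HB.pack_for {linear U -> V} f (GRing.isLinear.Build R U V *:%R f fl).

Lemma linear_sumZ (I : Type) (s : seq I) (P : pred I) (a : I -> R) (x : I ->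
  U) :
  linear f ->
  f (\sum_(j <- s | P j) a j *: x j) = \sum_(j <- s | P j) a j *: f (x j).
Proof.
move=> fl; rewrite -[LHS]/(to_linear fl _) linear_sum; apply: eq_bigr => j _.
exact: linearZ.
Qed.

Lemma linear_sumP (I : Type) (s : seq I) (P : pred I) (x : I -> U) :
  linear f -> f (\sum_(j <- s | P j) x j) = \sum_(j <- s | P j) f (x j).
Proof. by move=> fl; rewrite -[LHS]/(to_linear fl _) linear_sum. Qed.

Lemma linear_scale a x : linear f -> f (a *: x) = a *: f x.
Proof. by move=> fl; rewrite -[LHS]/(to_linear fl _) linearZ. Qed.

End LinearMaps.

Section Decomposition.
Variables (R : comNzRingType) (A : algType R).
Implicit Types (e g h : A).

(** Surjectivity of A (x) A^op -> End_R(A), stated with finite sums so that no tensor product has to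
    be formed. *)
Definition sandwich_full := forall h : {linear A -> A},
  exists s : seq (A * A), forall x, h x = \sum_(w <- s) w.1 * x * w.2.

(* An isomorphism of right A-modules between gA and the direct sum of the
   f i *: eA, for idempotents f i of R. *)
Definition decomposition e g k (f : 'I_k -> R) (x y : 'I_k -> A) :=
  [/\ forall i, g * x i = x i, forall i, x i * e = x i,
      forall i, e * y i = y i /\ y i * g = y i,
      forall i j, y i * x j = (f i *+ (i == j)) *: e &
      \sum_i x i * y i = g].

Lemma decomposition0 e (f : 'I_0 -> R) x y : decomposition e 0 f x y.
Proof. by split=> [[]|[]|[]|[]|] //; rewrite big_ord0. Qed.

(** With h = x0 y0 one splits gA into hA, a copy of f0 eA, and (g - h)A. The remaining x_j, y_j are
    fixed by g - h, which annihilates x0 and y0; hence the mixed products vanish. *)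
Lemma decomposition_cons e g k (f0 : R) (x0 y0 : A) (f : 'I_k ->
  R) (x y : 'I_k -> A) :
  g * g = g -> f0 *: x0 = x0 -> f0 *: y0 = y0 ->
  g * x0 = x0 -> x0 * e = x0 -> e * y0 = y0 -> y0 * g = y0 ->
  y0 * x0 = f0 *: e ->
  decomposition e (g - x0 * y0) f x y ->
  decomposition e g (fun i => oapp f f0 (unlift ord0 i))
    (fun i => oapp x x0 (unlift ord0 i)) (fun i => oapp y y0 (unlift ord0 i)).
Proof.
move=> gg fx fy gx xe ey yg yx [gX Xe EY YX sumXY].
pose h := x0 * y0; have gh : g * (g - h) = g - h by rewrite mulrBr gg mulrA gx.
have hg : (g - h) * g = g - h by rewrite mulrBl gg -mulrA yg.
have y0h : y0 * (g - h) = 0 by rewrite mulrBr yg mulrA yx -scalerAl ey fy subrr.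
have hx0 : (g - h) * x0 = 0.
  by rewrite mulrBl gx -mulrA yx -scalerAr xe fx subrr.
split.
- by move=> i; case: unliftP => [j|] _ //=; rewrite -gX mulrA gh.
- by move=> i; case: unliftP => [j|] _ //=.
- move=> i; case: unliftP => [j|] _ //=; have [eY Yg] := EY j.
  by split=> //; rewrite -Yg -mulrA hg.
- move=> i j; case: unliftP => [i'|] ->; case: unliftP => [j'|] -> /=.
  + by rewrite YX (inj_eq lift_inj).
  + have [_ <-] := EY i'; rewrite -mulrA hx0 mulr0.
    by rewrite mulr0n scale0r.
  + by rewrite -gX mulrA y0h mul0r mulr0n scale0r.
  + by rewrite mulr1n yx.
- rewrite big_ord_recl unlift_none /=; under eq_bigr do rewrite liftK /=.
  by rewrite sumXY addrC subrK.
Qed.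

End Decomposition.

Section VectorFacts.
Variables (K : fieldType) (V : vectType K).

Lemma dim_limg_inj (W : vectType K) (f : 'Hom(W, V)) :
  injective f -> \dim (limg f) = dim W.
Proof.
by move=> /lker0P/eqP f0; rewrite limg_dim_eq ?f0 ?capv0 // dimvf.
Qed.

Lemma dim_ffun (U : {vspace V}) (I : finType) :
  dim {ffun I -> subvs_of U} = (#|I| * \dim U)%N.
Proof. by []. Qed.

Lemma separating_functional (z : V) : z != 0 ->
  exists f : {linear V -> K^o}, f z = 1.
Proof.
move=> z0; exists (coord [tuple z] ord0).
have fz : free [tuple z] by rewrite seq1_free.
exact: (coord_free ord0 ord0 fz).
Qed.

End VectorFacts.

Section CentralSimple.
Variables (K : fieldType) (B : falgType K).
Hypothesis B_full : sandwich_full B.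
Implicit Types (e g x y z : B).

(** For a linear form f with f z = 1, the map sending x to f(x) 1 is a sum of sandwiches. Evaluated
    at z, it puts 1 in the two-sided ideal of z. *)
Lemma sandwich_simple z : z != 0 ->
  exists s : seq (B * B), \sum_(w <- s) w.1 * z * w.2 = 1.
Proof.
move=> /separating_functional[f fz].
pose h x := f x *: (1 : B).
have hl : linear h by move=> a x y; rewrite /h linearP scalerDl scalerA.
pose hL := to_linear hl.
have [s sE] := B_full hL; exists s.
by rewrite -sE /= /h fz scale1r.
Qed.

Lemma sandwich_prime x y : x != 0 -> y != 0 -> exists b, x * b * y != 0.
Proof.
move=> x0 y0; have [s s1] := sandwich_simple y0; apply: contrapT => H.
case/eqP: x0; rewrite -[x]mulr1 -s1 mulr_sumr big1_seq // => w _.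
have xwy : x * w.1 * y = 0.
  by apply/eqP/negP => /negP nz; apply: H; exists w.1.
by rewrite !mulrA xwy mul0r.
Qed.

Definition rideal x := limg (amull x).

Lemma ridealP x y : reflect (exists b, y = x * b) (y \in rideal x).
Proof.
apply: (iffP memv_imgP) => [[b _ ->]|[b ->]]; exists b;
  rewrite ?memvf ?lfunE //.
Qed.

Lemma rideal_id x : x \in rideal x.
Proof. by apply/ridealP; exists 1; rewrite mulr1. Qed.

Lemma ridealS x y : y \in rideal x -> (rideal y <= rideal x)%VS.
Proof.
move=> /ridealP[b ->]; apply/subvP => _ /ridealP[c ->]; apply/ridealP.
by exists (b * c); rewrite mulrA.
Qed.

(** The last clause gives every nonzero element of e B e a right inverse there, so e B e is a
    division algebra. *)
Definition primitive e := [/\ e != 0, e * e = e &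
  forall y, y != 0 -> e * y * e = y -> exists z, e * z * e = z /\ y * z = e].

(** Brauer's lemma: a nonzero right ideal I = x0 B of least dimension is generated by each of its
    nonzero elements. Primeness gives x in I with x x0 nonzero, and writing x as x e with e in I
    produces the idempotent. *)
Lemma primitive_exists : exists e, primitive e.
Proof.
pose P n := `[< exists2 x : B, x != 0 & \dim (rideal x) = n >].
have exP : exists n, P n.
  by exists (\dim (rideal 1)); apply/asboolP; exists 1; rewrite ?oner_neq0.
case: (ex_minnP exP) => n /asboolP[x0 x00 <-] min.
have rI y : y != 0 -> y \in rideal x0 -> rideal y = rideal x0.
  move=> y0 /ridealS yx; apply/eqP; rewrite eqEdim yx min //.
  by apply/asboolP; exists y.
have [b xbx] := sandwich_prime x00 x00; pose x := x0 * b.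
have xI : x \in rideal x0 by apply/ridealP; exists b.
have /(rI _ xbx) rxx : x * x0 \in rideal x0.
  by apply/ridealP; exists (b * x0); rewrite mulrA.
have : x \in rideal (x * x0) by rewrite rxx.
case/ridealP => c xE; have [e eE] : exists e, e = x0 * c by exists (x0 * c).
rewrite -mulrA -eE in xE.
have eI : e \in rideal x0 by apply/ridealP; exists c.
have e0 : e != 0.
  by apply: contraNneq xbx => e0; rewrite -/x xE e0 mulr0 mul0r.
(* A nonzero e e - e would generate I, but x = x e annihilates it on the left while x x0 is
   nonzero. *)
have ee : e * e = e.
  apply/eqP; rewrite -subr_eq0; apply: contraNT xbx => ne.
  have : x0 \in rideal (e * e - e).
    rewrite rI ?rideal_id //; apply/ridealP; exists (c * e - c).
    by rewrite mulrBr mulrA -eE.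
  move=> /ridealP[d x0E]; rewrite -/x [X in x * X]x0E mulrA mulrBr mulrA.
  by rewrite -!xE subrr mul0r.
exists e; split=> // y y0 eye.
have yI : y \in rideal x0.
  by apply/ridealP; exists (c * y * e); rewrite -[LHS]eye {1}eE !mulrA.
have : e \in rideal y by rewrite rI.
case/ridealP => z ez; exists (e * z * e).
have ye : y * e = y by rewrite -eye -mulrA ee.
by split; rewrite !mulrA ?ee ?ye -?ez // -mulrA ee.
Qed.

(** Primeness, used twice, yields a nonzero e b g c e. Inverting it in e B e makes e B a direct
    summand of g B. *)
Lemma primitive_embed e g : primitive e -> g != 0 -> g * g = g ->
  exists x y, [/\ g * x = x, x * e = x, e * y = y, y * g = y & y * x = e].
Proof.
move=> [e0 ee div] g0 gg; have [b ebg] := sandwich_prime e0 g0.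
have [c ebgce] := sandwich_prime ebg e0.
have [|z [eze yz]] := div (e * b * g * c * e) ebgce.
  by rewrite !mulrA ee -!mulrA ee.
have ze : z * e = z by rewrite -eze -mulrA ee.
exists (g * c * e * z), (e * b * g).
by split; rewrite ?mulrA ?gg ?ee // -?mulrA ?ze ?gg // mulrA (mulrA g) gg
  !mulrA.
Qed.

Lemma primitive_decomposition e g : primitive e -> g * g = g ->
  exists k (x y : 'I_k -> B), decomposition e g (fun=> 1) x y.
Proof.
move=> eP; have [n] := ubnP (\dim (rideal g)); elim: n => // n IH in g *.
rewrite ltnS => leg gg; have [->|g0] := eqVneq g 0.
  by exists 0%N, (fun=> 0), (fun=> 0); apply: decomposition0.
have [x [y [gx xe ey yg yx]]] := primitive_embed eP g0 gg.
have [h hE] : exists h, h = x * y by exists (x * y).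
have hx : h * x = x by rewrite hE -mulrA yx xe.
have hh : h * h = h by rewrite {2}hE mulrA hx.
have gh : g * h = h by rewrite hE mulrA gx.
have hg : h * g = h by rewrite hE -mulrA yg.
have g'g' : (g - h) * (g - h) = g - h.
  by rewrite mulrBr !mulrBl gg gh hg hh subrr subr0.
(* Otherwise x would lie in (g - h)B, which h kills, although h x = x and y x = e is nonzero. *)
have lt_dim : (\dim (rideal (g - h)%R) < \dim (rideal g))%N.
  rewrite ltnNge; apply/negP => le_dim.
  have sub : (rideal (g - h) <= rideal g)%VS.
    by apply/ridealS/ridealP; exists (1 - h); rewrite mulrBr mulr1 gh.
  have : x \in rideal (g - h).
    have -> : rideal (g - h) = rideal g by apply/eqP; rewrite eqEdim sub.
    by apply/ridealP; exists x.
  case/ridealP => b xE; have [e0 _ _] := eP; case/eqP: e0.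
  suff x0 : x = 0 by rewrite -yx x0 mulr0.
  by rewrite -hx xE mulrA mulrBr hg hh subrr mul0r.
have [k [x' [y' dec]]] := IH (g - h) (leq_trans lt_dim leg) g'g'.
exists k.+1, (fun i => oapp x' x (unlift ord0 i)), (fun i =>
  oapp y' y (unlift ord0 i)).
have := @decomposition_cons _ _ e g k 1 x y (fun=> 1) x' y' gg.
rewrite !scale1r -hE => /(_ erefl erefl gx xe ey yg yx dec).
congr decomposition; apply/funext => i.
by case: unlift.
Qed.

(** The space g B g'; for idempotents this is Hom_B(g' B, g B). *)
Definition hom_space g g' :=
  limg (linfun (sandwich_fun g g' : {linear B -> B})).

Lemma hom_spaceP g g' y : g * g = g -> g' * g' = g' ->
  reflect (g * y * g' = y) (y \in hom_space g g').
Proof.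
move=> gg gg'; apply: (iffP memv_imgP) => [[b _ ->]|<-].
  by rewrite lfunE /= /sandwich_fun !mulrA gg -!mulrA gg'.
by exists y; rewrite ?memvf ?lfunE.
Qed.

(** The entries y_i z x'_j identify g B g' with the k by k' matrices over e B e. *)
Lemma decomposition_dim e g g' k k' (x y : 'I_k -> B) (x' y' : 'I_k' -> B) :
  e * e = e -> g * g = g -> g' * g' = g' ->
  decomposition e g (fun _ : 'I_k => 1) x y ->
  decomposition e g' (fun _ : 'I_k' => 1) x' y' ->
  \dim (hom_space g g') = (k * k' * \dim (hom_space e e))%N.
Proof.
move=> ee gg gg' [gx xe ey yx xy] [gx' xe' ey' yx' xy'].
pose D := hom_space e e.
pose F (M : {ffun 'I_k * 'I_k' -> subvs_of D}) :=
  \sum_i \sum_j x i * vsval (M (i, j)) * y' j.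
have Fl : linear F.
  move=> a M N; rewrite /F scaler_sumr -big_split /=; apply: eq_bigr => i _.
  rewrite scaler_sumr -big_split /=; apply: eq_bigr => j _.
  by rewrite !ffunE linearP /= mulrDr mulrDl -scalerAr -scalerAl.
pose f := linfun (to_linear Fl).
have DP (w : subvs_of D) : e * vsval w * e = vsval w.
  by apply/(hom_spaceP _ ee ee); apply: subvsP.
have fK M i j : y i * f M * x' j = vsval (M (i, j)).
  rewrite lfunE /= /F mulr_sumr mulr_suml (bigD1 i) //= [X in _ + X]big1;
    last first.
    move=> i' ii'; rewrite mulr_sumr mulr_suml big1 // => j' _.
    by rewrite !mulrA yx eq_sym (negPf ii') mulr0n scale0r !mul0r.
  rewrite addr0 mulr_sumr mulr_suml (bigD1 j) //= [X in _ + X]big1; last first.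
    move=> j' jj'; rewrite -!mulrA yx' (negPf jj') mulr0n scale0r.
    by rewrite !mulr0.
  by rewrite addr0 !mulrA yx eqxx scale1r -!mulrA yx' eqxx scale1r mulrA DP.
have f_inj : injective f.
  by move=> M N MN; apply/ffunP => -[i j]; apply: val_inj; rewrite /= -!fK MN.
have -> : hom_space g g' = limg f.
  apply/vspaceP => z; apply/(hom_spaceP _ gg gg')/memv_imgP => [gz|[M _ ->]].
    exists [ffun ij => vsproj D (y ij.1 * z * x' ij.2)]; rewrite ?memvf //.
    rewrite lfunE /= /F -[LHS]gz -{1}xy -{1}xy' mulr_suml mulr_suml.
    apply: eq_bigr => i _; rewrite mulr_sumr; apply: eq_bigr => j _.
    rewrite ffunE vsprojK /=; last first.
      apply/(hom_spaceP _ ee ee); rewrite !mulrA (ey i).1 -!mulrA.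
      by rewrite xe'.
    by rewrite !mulrA.
  rewrite lfunE /= /F mulr_sumr mulr_suml; apply: eq_bigr => i _.
  rewrite mulr_sumr mulr_suml; apply: eq_bigr => j _.
  by rewrite !mulrA gx -!mulrA (ey' j).2.
by rewrite dim_limg_inj // dim_ffun card_prod !card_ord.
Qed.

Lemma decomposition_compare e g g' k k' (x y : 'I_k -> B) (x' y' : 'I_k' -> B) :
  (k <= k')%N ->
  decomposition e g (fun _ : 'I_k => 1) x y ->
  decomposition e g' (fun _ : 'I_k' => 1) x' y' ->
  exists u v, u * g' * v = g.
Proof.
move=> kk' [gx xe ey yx xy] [gx' xe' ey' yx' xy'].
exists (\sum_i x i * y' (widen_ord kk' i)), (\sum_i x' (widen_ord kk' i) * y i).
rewrite mulr_suml mulr_suml -xy; apply: eq_bigr => i _.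
rewrite mulr_sumr (bigD1 i) //= big1 ?addr0.
  by rewrite -!mulrA (mulrA g') gx' (mulrA (y' _)) yx' eqxx scale1r !mulrA xe.
move=> j ji; rewrite -!mulrA (mulrA g') gx' (mulrA (y' _)) yx'.
rewrite -(inj_eq val_inj) /= -[_ == _ :> nat]/(_ == _) eq_sym (inj_eq val_inj).
by rewrite (negPf ji) mulr0n scale0r mul0r mulr0.
Qed.

Section DivisionCorner.
Variable e : B.
Hypothesis eP : primitive e.
Local Notation D := (hom_space e e).

Let e_neq0 : e != 0. Proof. by case: eP. Qed.
Let ee : e * e = e. Proof. by case: eP. Qed.

Let cornerP x : reflect (e * x * e = x) (x \in D).
Proof. exact: hom_spaceP. Qed.

Let cornerE x : e * x * e \in D.
Proof. by apply/cornerP; rewrite !mulrA ee -!mulrA ee. Qed.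

Let corner_el x : x \in D -> e * x = x.
Proof. by move=> /cornerP <-; rewrite !mulrA ee. Qed.

Let corner_er x : x \in D -> x * e = x.
Proof. by move=> /cornerP <-; rewrite -!mulrA ee. Qed.

Let cornerM x y : x \in D -> y \in D -> x * y \in D.
Proof.
by move=> xD yD; apply/cornerP; rewrite mulrA corner_el // -mulrA corner_er.
Qed.

Let corner_inv x : x \in D -> x != 0 ->
  exists2 y, y \in D & x * y = e /\ y * x = e.
Proof.
have [_ _ div] := eP.
have rinv u : u \in D -> u != 0 -> exists2 v, v \in D & u * v = e.
  move=> uD u0; have [|v [ev uv]] := div u u0; first by apply/cornerP.
  by exists v => //; apply/cornerP.
move=> xD x0; have [y yD xy] := rinv x xD x0; exists y => //; split=> //.
have y0 : y != 0 by apply: contraNneq e_neq0 => y0; rewrite -xy y0 mulr0.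
have [z zD yz] := rinv y yD y0.
by rewrite -yz -[in RHS](corner_el zD) -[in RHS]xy -[in RHS](mulrA x) yz
  (corner_er xD).
Qed.

Local Notation n := (\dim D).
Local Notation b i := (tnth (vbasis D) i).

Let bD i : b i \in D. Proof. by apply: vbasis_mem; apply: mem_tnth. Qed.

(* If coord_j(x) e = \sum p x q on D, then \sum p (\sum_i b_i q w_i) = w_j. *)
Lemma corner_sandwich_inj (w : 'I_n -> B) : (forall i, w i \in D) ->
  (forall x, x \in D -> \sum_i b i * x * w i = 0) -> forall i, w i = 0.
Proof.
move=> wD w0 j.
pose h x := coord (vbasis D) j x *: e.
have hl : linear h by move=> a x y; rewrite /h linearP scalerDl scalerA.
pose hL := to_linear hl.
have [s sE] := B_full hL.
have hb i : h (b i) = (i == j)%:R *: e.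
  rewrite /h (tnth_nth 0) coord_free 1?eq_sym //.
  exact: basis_free (vbasisP D).
have key i : \sum_(pq <- s) pq.1 * (b i * (e * pq.2 * e) * w i) =
    (i == j)%:R *: w i.
  rewrite -[in RHS](corner_el (wD i)) scalerAl -hb -[h _]/(hL _) sE mulr_suml.
  apply: eq_bigr => pq _; rewrite !mulrA -(mulrA _ e (w i)) corner_el //.
  by rewrite -(mulrA _ (b i) e) corner_er.
have : \sum_(pq <- s) pq.1 * (\sum_i b i * (e * pq.2 * e) * w i) = 0.
  by apply: big1 => pq _; rewrite w0 ?mulr0.
under eq_bigr do rewrite mulr_sumr.
rewrite exchange_big /=; under eq_bigr do rewrite key.
rewrite (bigD1 j) //= eqxx scale1r big1 ?addr0 // => i ij.
by rewrite (negPf ij) scale0r.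
Qed.

(** In a sandwich expression of h, compress both factors by e and expand the left ones in the basis
    b of D; the w_i collect the right factors. *)
Lemma corner_sandwich_surj (h : {linear B -> B}) :
  exists2 w : 'I_n -> B, forall i, w i \in D &
    forall x, x \in D -> e * h x * e = \sum_i b i * x * w i.
Proof.
have [s sE] := B_full h.
exists (fun i => \sum_(pq <- s) coord (vbasis D) i (e * pq.1 * e) *: (e * pq.2
  * e)).
  by move=> i; apply: rpred_sum => pq _; rewrite rpredZ.
move=> x xD; rewrite sE mulr_sumr mulr_suml.
under [RHS]eq_bigr do rewrite mulr_sumr.
rewrite exchange_big /=; apply: eq_bigr => pq _.
have -> : e * (pq.1 * x * pq.2) * e = (e * pq.1 * e) * x * (e * pq.2 * e).
  by rewrite !mulrA -(mulrA _ e x) (corner_el xD) -(mulrA _ x e) (corner_er xD).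
rewrite {1}(coord_vbasis (cornerE pq.1)) !mulr_suml; apply: eq_bigr => i _.
by rewrite -!scalerAl -scalerAr (tnth_nth 0).
Qed.

(** Take a commuting subspace of largest dimension. Adjoining an element of D that commutes with it
    keeps it commuting, so L is its own centralizer in D. *)
Lemma max_commuting_subspace : exists L : {vspace B},
  [/\ (L <= D)%VS, forall u v, u \in L -> v \in L -> u * v = v * u &
      forall z, z \in D -> (forall u, u \in L -> u * z = z * u) -> z \in L].
Proof.
pose P l := `[< exists L : {vspace B}, [/\ (L <= D)%VS, \dim L = l &
  forall u v, u \in L -> v \in L -> u * v = v * u] >].
have exP : exists l, P l.
  exists 0%N; apply/asboolP; exists 0%VS; split; rewrite ?sub0v ?dimv0 //.
  by move=> u v; rewrite !memv0 => /eqP-> /eqP->.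
have leP l : P l -> (l <= n)%N by move=> /asboolP[L [LD <- _]]; rewrite dimvS.
case: (ex_maxnP exP leP) => l /asboolP[L [LD dimL Lcomm]] max.
exists L; split=> // z zD zL; apply: contrapT => /negP nzL.
suff /max : P (\dim (L + <[z]>)%VS).
  rewrite -dimL leqNgt => /negP; apply; rewrite ltnNge; apply: contra nzL => le.
  have /eqP -> : (L == L + <[z]>)%VS by rewrite eqEdim addvSl.
  by apply: (subvP (addvSr _ _)); rewrite memv_line.
apply/asboolP; exists (L + <[z]>)%VS; split=> //.
  by rewrite subv_add LD -memvE.
move=> _ _ /memv_addP[u uL [_ /vlineP[a ->] ->]] /memv_addP[v vL [_ /vlineP[c
  ->] ->]].
rewrite !mulrDl !mulrDr (Lcomm u v) // -!scalerAl -!scalerAr zL // (zL v) //.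
by rewrite -!addrA; congr (_ + _); rewrite addrCA !scalerA (mulrC a).
Qed.

(* With L a maximal commutative subfield of the division algebra D, L^t = D as a
   right L-space and n = dim D, the right L-linear endomorphisms of D correspond
   both to L^n, as the maps x |-> \sum_i b_i x w_i, and to D^t, by their values
     on
   an L-basis. Hence n dim L = t n, so that t = dim L. *)
Lemma primitive_square : exists2 l, (0 < l)%N & \dim D = (l ^ 2)%N.
Proof.
have [L [LD Lcomm Lmax]] := max_commuting_subspace.
have LinD u : u \in L -> u \in D by apply: (subvP LD).
have eL : e \in L.
  apply: Lmax => [|u uL]; first by apply/cornerP; rewrite ee ee.
  by rewrite corner_el ?corner_er ?LinD.
have LM u v : u \in L -> v \in L -> u * v \in L.
  move=> uL vL; apply: Lmax => [|w wL]; first by rewrite cornerM ?LinD.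
  by rewrite mulrA (Lcomm w u) // -!mulrA (Lcomm w v).
have Linv u : u \in L -> u != 0 -> exists2 v, v \in L & u * v = e.
  move=> uL u0; have [v vD [uv vu]] := corner_inv (LinD _ uL) u0.
  exists v => //; apply: Lmax => // w wL.
  rewrite -(corner_el (cornerM (LinD _ wL) vD)) -vu !mulrA -(mulrA v u w).
  rewrite (Lcomm u w) // -!mulrA uv corner_er // LinD //.
pose indep t (d : 'I_t -> B) := (forall j, d j \in D) /\
  forall c : 'I_t -> B, (forall j, c j \in L) -> \sum_j d j * c j = 0 ->
    forall j, c j = 0.
pose F t (d : 'I_t -> B) (c : {ffun 'I_t -> subvs_of L}) :=
  \sum_j d j * vsval (c j).
have Fl t d : linear (F t d).
  move=> a M N; rewrite /F scaler_sumr -big_split /=; apply: eq_bigr => j _.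
  by rewrite !ffunE linearP /= mulrDr -scalerAr.
pose FL t d := to_linear (Fl t d).
have FE t d c : linfun (FL t d) c = \sum_j d j * vsval (c j) by rewrite lfunE.
have Finj t d : indep t d -> injective (linfun (FL t d)).
  move=> [_ dI]; apply: raddf_inj => c /(etrans (esym (FE _ _ _)))/dI c0.
  apply/ffunP => j; rewrite ffunE; apply: val_inj => /=.
  by apply: c0 => k; apply: subvsP.
have FD t d : indep t d -> (limg (linfun (FL t d)) <= D)%VS.
  move=> [dD _]; apply/subvP => _ /memv_imgP[c _ ->]; rewrite FE.
  by apply: rpred_sum => j _; rewrite cornerM // LinD // subvsP.
pose P t := `[< exists d, indep t d >].
have l0 : (0 < \dim L)%N.
  by rewrite lt0n dimv_eq0; apply: contraNneq e_neq0 => L0; rewrite -memv0 -L0.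
have exP : exists t, P t.
  by exists 0%N; apply/asboolP; exists (fun=> 0); split=> [[]|c _ _ []].
have leP t : P t -> (t <= n)%N.
  move=> /asboolP[d dP]; have := dimvS (FD t d dP).
  rewrite dim_limg_inj; last exact: Finj.
  by rewrite dim_ffun card_ord; apply: leq_trans; rewrite leq_pmulr.
case: (ex_maxnP exP leP) => t /asboolP[d dP] max.
have [dD dI] := dP.
(* A maximal L-independent family spans: if z were outside the span, adjoining z would keep
   independence, since a nonzero coefficient of z could be inverted in L. *)
have Fsurj : limg (linfun (FL t d)) = D.
  apply/eqP; rewrite eqEsubv FD //=; apply/subvP => z zD; apply: contrapT => nz.
  suff /max : P t.+1 by rewrite ltnn.
  apply/asboolP; exists (fun i => oapp d z (unlift ord0 i)); split.
    by move=> j; case: unliftP => [j'|] _ //=.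
  move=> c cL; rewrite big_ord_recl unlift_none /=.
  under eq_bigr do rewrite liftK /=.
  move=> c0.
  have c00 : c ord0 = 0.
    apply: contrapT => /eqP c00; have [v vL cv] := Linv _ (cL ord0) c00.
    case: nz; apply/memv_imgP.
    exists [ffun j => vsproj L (- (c (lift ord0 j) * v))]; first exact: memvf.
    rewrite FE -[LHS](corner_er zD) -cv mulrA.
    have /eqP := c0; rewrite addr_eq0 => /eqP ->.
    rewrite mulNr mulr_suml -sumrN; apply: eq_bigr => j _.
    by rewrite ffunE vsprojK ?rpredN ?LM // mulrN mulrA.
  move=> j; case: (unliftP ord0 j) => [j'|] -> //.
  by move: c0; rewrite c00 mulr0 add0r => /dI; apply.
have nE : n = (t * \dim L)%N.
  by rewrite -[LHS](congr1 (fun U : {vspace B} =>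
    \dim U) Fsurj) dim_limg_inj ?dim_ffun ?card_ord //; apply: Finj.
suff tl : t = \dim L by exists (\dim L) => //; rewrite nE {1}tl.
(* G evaluates the right L-linear map with coefficients w on the L-basis d. Its bijectivity is the
   equality n dim L = t n. *)
pose G (w : {ffun 'I_n -> subvs_of L}) : {ffun 'I_t -> subvs_of D} :=
  [ffun j => vsproj D (\sum_i b i * d j * vsval (w i))].
have GE w j : vsval (G w j) = \sum_i b i * d j * vsval (w i).
  rewrite ffunE vsprojK //; apply: rpred_sum => i _.
  by rewrite !cornerM // LinD // subvsP.
have Gl : linear G.
  move=> a u v; apply/ffunP => j; apply: val_inj.
  have -> : (a *: G u + G v) j = a *: G u j + G v j.
    by rewrite [LHS]ffunE [X in X + _]ffunE.
  rewrite -[LHS]/(vsval _) -[RHS]/(vsval _) linearP /= !GE scaler_sumr.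
  rewrite -big_split /=; apply: eq_bigr => i _.
  by rewrite !ffunE linearP /= mulrDr -scalerAr.
pose GL := to_linear Gl.
have GLE c : linfun GL c = G c by rewrite lfunE.
have Dd x : x \in D -> exists c : {ffun 'I_t ->
  subvs_of L}, linfun (FL t d) c = x.
  by rewrite -Fsurj => /memv_imgP[c _ ->]; exists c.
have Ginj : injective (linfun GL).
  apply: raddf_inj => w /(etrans (esym (GLE _))) w0.
  apply/ffunP => i; rewrite ffunE; apply: val_inj; rewrite /=.
  apply: (@corner_sandwich_inj (fun i => vsval (w i))) => [k|x].
    by rewrite LinD // subvsP.
  move=> /Dd[c]; rewrite FE => <-.
  under eq_bigr do rewrite mulr_sumr mulr_suml.
  rewrite exchange_big big1 //= => j _.
  transitivity ((\sum_i b i * d j * vsval (w i)) * vsval (c j)).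
    rewrite mulr_suml; apply: eq_bigr => k _.
    by rewrite -!mulrA (Lcomm (vsval (c j))) // subvsP.
  by rewrite -GE w0 ffunE /= mul0r.
have Gsurj : limg (linfun GL) = fullv.
  apply/eqP; rewrite eqEsubv subvf /=; apply/subvP => z _; apply/memv_imgP.
  pose c x := (linfun (FL t d))^-1%VF x.
  have cK x : x \in D -> linfun (FL t d) (c x) = x.
    by rewrite -Fsurj; apply: limg_lfunVK.
  have Kc w : c (linfun (FL t d) w) = w.
    by apply: lker0_lfunK; apply/lker0P/Finj.
  (* The right L-linear map taking the prescribed value z_j at d_j, where c gives the
     L-coordinates. *)
  pose h x := \sum_j vsval (z j) * vsval (c x j).
  have hl : linear h.
    move=> a x y; rewrite /h scaler_sumr -big_split /=; apply: eq_bigr => j _.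
    by rewrite /c linearP !ffunE /= mulrDr -scalerAr.
  pose hL := to_linear hl.
  have [w wD wE] := corner_sandwich_surj hL.
  have hM x u : x \in D -> u \in L -> h (x * u) = h x * u.
    move=> xD uL; rewrite /h mulr_suml.
    have -> : x * u = linfun (FL t d) [ffun j => vsproj L (vsval (c x j) * u)].
      rewrite FE -{1}(cK x xD) FE mulr_suml; apply: eq_bigr => j _.
      by rewrite ffunE vsprojK ?mulrA // LM ?subvsP.
    apply: eq_bigr => j _.
    by rewrite Kc ffunE vsprojK ?mulrA // LM ?subvsP.
  (* Right L-linearity of h makes the commutators u w_i - w_i u the coefficients of the zero map, so
     they vanish, and L contains its centralizer. *)
  have wL i : w i \in L.
    apply: Lmax => // u uL; apply/eqP; rewrite -subr_eq0; apply/eqP.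
    apply: (@corner_sandwich_inj (fun i => u * w i - w i * u)) => [k|x xD].
      by apply: rpredB; apply: cornerM => //; apply: LinD.
    under eq_bigr do rewrite mulrBr.
    rewrite sumrB; apply/eqP; rewrite subr_eq0; apply/eqP.
    transitivity (e * hL (x * u) * e).
      rewrite wE; last by apply: cornerM => //; apply: LinD.
      by apply: eq_bigr => k _; rewrite !mulrA.
    rewrite /= hM // -mulrA -(mulrA (h x)) corner_er ?LinD //.
    rewrite -{1}(corner_el (LinD _ uL)) !mulrA -[h x]/(hL x) wE // mulr_suml.
    by apply: eq_bigr => k _; rewrite !mulrA.
  exists [ffun i => vsproj L (w i)]; rewrite ?memvf // GLE.
  apply/ffunP => j; apply: val_inj; rewrite /= GE.
  have -> : vsval (z j) = e * hL (d j) * e.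
    rewrite /= /h.
    have -> : d j = linfun (FL t d) [ffun k =>
      if k == j then vsproj L e else 0].
      rewrite FE (bigD1 j) //= big1 ?addr0 => [|k kj].
        by rewrite ffunE eqxx vsprojK // corner_er.
      by rewrite ffunE (negPf kj) /= mulr0.
    rewrite (bigD1 j) //= big1 ?addr0 => [|k kj].
      by rewrite Kc ffunE eqxx vsprojK // corner_er ?corner_el ?corner_er
        ?subvsP.
    by rewrite Kc ffunE (negPf kj) /= mulr0.
  by rewrite wE //; apply: eq_bigr => i _; rewrite ffunE vsprojK.
have := dim_limg_inj Ginj; rewrite Gsurj dimvf !dim_ffun !card_ord nE.
have n0 : (0 < t * \dim L)%N.
  rewrite -nE lt0n dimv_eq0; apply: contraNneq e_neq0 => D0.
  by rewrite -memv0 -D0 LinD.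
by rewrite mulnC => /eqP; rewrite eqn_pmul2l // => /eqP.
Qed.

End DivisionCorner.

(** For a fixed primitive e, s g is the number of copies of e B in g B, and l ^ 2 is the dimension
    of e B e. *)
Theorem central_simple_structure : exists (l : nat) (s : B -> nat),
  [/\ (0 < l)%N, (0 < s 1%R)%N,
    forall g g', g * g = g -> g' * g' = g' ->
      \dim (hom_space g g') = (s g * s g' * l ^ 2)%N &
    forall g g', g * g = g -> g' * g' = g' -> (s g <= s g')%N ->
      exists u v, u * g' * v = g].
Proof.
have [e eP] := primitive_exists; have [l l0 lE] := primitive_square eP.
have [e0 ee _] := eP.
have /choice[s sP] (g : B) : exists k, g * g = g ->
    exists x y : 'I_k -> B, decomposition e g (fun=> 1) x y.
  have [gg|ngg] := pselect (g * g = g); last by exists 0%N.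
  by have [k [x [y dec]]] := primitive_decomposition eP gg; exists k => _;
    exists x, y.
exists l, s; split=> //.
- have [x [y [_ _ _ _ xy]]] := sP 1 (mulr1 1).
  rewrite lt0n; apply: contra_neq (oner_neq0 B) => s0.
  rewrite -xy big1 // => -[i lti]; exfalso; by rewrite s0 in lti.
- move=> g g' gg gg'; have [x [y dec]] := sP g gg;
  have [x' [y' dec']] := sP g' gg'.
  by rewrite (decomposition_dim ee gg gg' dec dec') lE.
- move=> g g' gg gg' le; have [x [y dec]] := sP g gg.
  have [x' [y' dec']] := sP g' gg'; exact: decomposition_compare le dec dec'.
Qed.

End CentralSimple.

(** * Reduction modulo a maximal ideal *)

Record coordinates (R : comNzRingType) (M : lmodType R) := Coordinates {
  cdim : nat;
  cmap : {linear M -> 'rV[R]_cdim};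
  csec : {linear 'rV[R]_cdim -> M};
  cmapK : cancel cmap csec }.

Section Coordinates.
Variables (R : comNzRingType) (M : lmodType R) (c : coordinates M).
Local Notation n := (cdim c).
Local Notation i := (cmap c).
Local Notation r := (csec c).

Definition coord_basis j : M := r (delta_mx 0 j).
Definition coord_proj : 'M[R]_n := lin1_mx (i \o r).
(** For linear h, the rank of the operator induced on M (x) k(p). For an idempotent h it is the rank
    at p of the image of h, see [retract_rk]. *)
Definition op_rank (p : prime_idealr R) (h : M -> M) : nat :=
  \rank (residue_mx p (lin1_mx (i \o h \o r))).

Lemma coord_expand x : x = \sum_j i x 0 j *: coord_basis j.
Proof. exact: coord_sum (cmapK c) x. Qed.

(** Otherwise the projection matrix vanishes modulo p. Then det(1 - pi) lies outside p but
    annihilates M, by the adjugate. *)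
Lemma faithful_coord (p : prime_idealr R) : faithful M ->
  exists j k, i (coord_basis j) 0 k \notin p.
Proof.
move=> fM; apply: contrapT => H.
have pi0 : residue_mx p coord_proj = 0.
  apply/matrixP => j k; rewrite [LHS]mxE [RHS]mxE; apply/eqP.
  rewrite residue_eq0; apply: contrapT => /negP jk; apply: H; exists j, k.
  by move: jk; rewrite mxE.
have : \det (1%:M - coord_proj) \notin p.
  rewrite -residue_eq0 residue_det map_mxB map_mx1 pi0 subr0 det1.
  exact: oner_neq0.
suff -> : \det (1%:M - coord_proj) = 0 by rewrite rpred0.
apply: fM => x; apply: (can_inj (cmapK c)); rewrite linearZ /= linear0.
rewrite -mul_mx_scalar -mul_mx_adj mulmxA mulmxBr mulmx1.
by rewrite (coord_mul (cmapK c)) subrr mul0mx.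
Qed.

End Coordinates.

Lemma dim_limg_mulmxr (K : fieldType) a b (X : 'M[K]_(a, b)) :
  \dim (limg (linfun (mulmxr X : {linear 'rV_a -> 'rV_b}))) = \rank X.
Proof.
have fE (Y : 'M[K]_(\rank X, b)) u : linfun (mulmxr Y : {linear 'rV__ ->
  'rV__}) u = u *m Y.
  by rewrite lfunE.
have inj : injective (linfun (mulmxr (row_base X) : {linear 'rV__ -> 'rV__})).
  by move=> u v; rewrite !fE => /(row_free_inj (row_base_free X)).
have -> : limg (linfun (mulmxr X : {linear 'rV_a -> 'rV_b})) =
    limg (linfun (mulmxr (row_base X) : {linear 'rV__ -> 'rV__})).
  apply/vspaceP => u; apply/memv_imgP/memv_imgP => -[w _ ->].
    exists (w *m col_base X); rewrite ?memvf // fE lfunE /=.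
    by rewrite -mulmxA mulmx_base.
  have /row_fullP[Y YK] := col_base_full X.
  exists (w *m Y); rewrite ?memvf // fE lfunE /=.
  transitivity (w *m Y *m (col_base X *m row_base X));
    last by rewrite mulmx_base.
  by rewrite -mulmxA (mulmxA Y) YK mul1mx.
by rewrite dim_limg_inj // [LHS]mul1n.
Qed.

Section Reduction.
Variables (R : comNzRingType) (A : algType R) (c : coordinates A).
Variable m : prime_idealr R.
Local Notation n := (cdim c).
Local Notation i := (cmap c).
Local Notation r := (csec c).
Local Notation K := (residue_field m).
Local Notation res := (residue m).

(** A / mA is realised as the image of the reduced projection in K^n instead of a quotient, which
    provides a finite-dimensional [vectType]. *)
Definition reduction_space : {vspace 'rV[K]_n} :=
  limg (linfun (mulmxr (residue_mx m (coord_proj c)) : {linear 'rV_n ->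
    'rV_n})).

(* A / mA, where the two arguments record that m is maximal and that A / mA is
   nonzero. *)
Definition reduction (m_max : maximal m) (fA : faithful A) : Type :=
  subvs_of reduction_space.

Variables (m_max : maximal m) (fA : faithful A).
Local Notation B := (reduction m_max fA).

HB.instance Definition _ := Vector.on B.

Definition res_coord (a : A) : 'rV[K]_n := residue_mx m (i a).
Definition reduce (a : A) : B := vsproj reduction_space (res_coord a).
Definition res_lift (k : K) : R := sval (cid (residue_surj m_max k)).
Definition reduce_lift (t : B) : A :=
  r (map_mx res_lift (vsval (t : subvs_of reduction_space))).

Lemma res_liftK k : res (res_lift k) = k.
Proof. exact: svalP (cid (residue_surj m_max k)). Qed.

Lemma res_coordB a b : res_coord (a - b) = res_coord a - res_coord b.
Proof. by rewrite /res_coord linearB map_mxB. Qed.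

Lemma res_coordZ x a : res_coord (x *: a) = res x *: res_coord a.
Proof. by rewrite /res_coord linearZ map_mxZ. Qed.

Lemma res_coord_sum (I : Type) (s : seq I) (P : pred I) (F : I -> A) :
  res_coord (\sum_(j <- s | P j) F j) = \sum_(j <- s | P j) res_coord (F j).
Proof. by rewrite /res_coord linear_sum map_mx_sum. Qed.

Lemma res_coord_proj a :
  res_coord a *m residue_mx m (coord_proj c) = res_coord a.
Proof. by rewrite -map_mxM (coord_mul (cmapK c)). Qed.

Lemma res_coord_in a : res_coord a \in reduction_space.
Proof.
apply/memv_imgP; exists (res_coord a); rewrite ?memvf //.
by rewrite lfunE /= res_coord_proj.
Qed.

Lemma val_reduce a : vsval (reduce a : subvs_of _) = res_coord a.
Proof. by rewrite /reduce vsprojK ?res_coord_in. Qed.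

Lemma reduce_eq a b : reduce a = reduce b <-> res_coord a = res_coord b.
Proof.
split=> [/(congr1 (fun t : subvs_of _ => vsval t))|ab];
  first by rewrite !val_reduce.
by rewrite /reduce ab.
Qed.

Lemma reduce_liftK t : reduce (reduce_lift t) = t.
Proof.
apply: val_inj; rewrite /= val_reduce /res_coord /reduce_lift.
set w := map_mx res_lift _.
have wE : residue_mx m w = vsval (t : subvs_of _).
  by apply/matrixP => a b; rewrite !mxE res_liftK.
rewrite -[i (r w)](mul_rV_lin1 (i \o r)) map_mxM wE.
have /memv_imgP[u _ ->] := subvsP (t : subvs_of reduction_space).
rewrite lfunE /= -mulmxA -map_mxM; congr (_ *m map_mx _ _).
by apply/row_matrixP => j; rewrite row_mul row_coord (coord_mul (cmapK c)).
Qed.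

Lemma reduce_surj t : exists a, t = reduce a.
Proof. by exists (reduce_lift t); rewrite reduce_liftK. Qed.

Lemma res_coord0M a b : res_coord a = 0 -> res_coord (a * b) = 0.
Proof.
move=> a0; rewrite {1}(coord_expand c a) mulr_suml res_coord_sum big1 // => j _.
rewrite -scalerAl res_coordZ; have /rowP/(_ j) := a0; rewrite !mxE => ->.
by rewrite scale0r.
Qed.

Lemma res_coordM0 a b : res_coord b = 0 -> res_coord (a * b) = 0.
Proof.
move=> b0; rewrite {1}(coord_expand c b) mulr_sumr res_coord_sum big1 // => j _.
rewrite -scalerAr res_coordZ; have /rowP/(_ j) := b0; rewrite !mxE => ->.
by rewrite scale0r.
Qed.

Definition reduction_mul (t u : B) : B :=
  reduce (reduce_lift t * reduce_lift u).

Lemma reduce_mul a b : reduce (a * b) = reduction_mul (reduce a) (reduce b).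
Proof.
apply/reduce_eq/eqP; set a' := reduce_lift _; set b' := reduce_lift _.
have aa : res_coord (a - a') = 0.
  by rewrite res_coordB; apply/eqP; rewrite subr_eq0; apply/eqP/reduce_eq;
    rewrite reduce_liftK.
have bb : res_coord (b - b') = 0.
  by rewrite res_coordB; apply/eqP; rewrite subr_eq0; apply/eqP/reduce_eq;
    rewrite reduce_liftK.
rewrite -subr_eq0 -res_coordB.
have -> : a * b - a' * b' = (a - a') * b - a' * (b' - b).
  by rewrite mulrBl mulrBr opprB addrA subrK.
by rewrite res_coordB res_coord0M // res_coordM0 ?subr0 // -opprB -sub0r
  res_coordB bb subr0 /res_coord linear0 map_mx0.
Qed.

Lemma reduceB a b : reduce (a - b) = reduce a - reduce b.
Proof. by rewrite /reduce res_coordB [LHS]linearB. Qed.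

Lemma reduce0 : reduce 0 = 0.
Proof. by have := reduceB 0 0; rewrite !subrr. Qed.

Lemma reduceD a b : reduce (a + b) = reduce a + reduce b.
Proof.
by rewrite -[b in LHS]opprK reduceB -[- b]sub0r reduceB reduce0 sub0r opprK.
Qed.

Lemma reduceZ x a : reduce (x *: a) = res x *: reduce a.
Proof. by rewrite /reduce res_coordZ [LHS]linearZ. Qed.

Fact reduction_mulA : associative reduction_mul.
Proof.
move=> t u v; have [a ->] := reduce_surj t; have [b ->] := reduce_surj u.
by have [d ->] := reduce_surj v; rewrite -!reduce_mul mulrA.
Qed.

Fact reduction_mul1 : left_id (reduce 1) reduction_mul.
Proof. by move=> t; have [a ->] := reduce_surj t;
  rewrite -reduce_mul mul1r. Qed.

Fact reduction_mulr1 : right_id (reduce 1) reduction_mul.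
Proof. by move=> t; have [a ->] := reduce_surj t;
  rewrite -reduce_mul mulr1. Qed.

Fact reduction_mulDl : left_distributive reduction_mul +%R.
Proof.
move=> t u v; have [a ->] := reduce_surj t; have [b ->] := reduce_surj u.
by have [d ->] := reduce_surj v; rewrite -reduceD -!reduce_mul mulrDl reduceD.
Qed.

Fact reduction_mulDr : right_distributive reduction_mul +%R.
Proof.
move=> t u v; have [a ->] := reduce_surj t; have [b ->] := reduce_surj u.
by have [d ->] := reduce_surj v; rewrite -reduceD -!reduce_mul mulrDr reduceD.
Qed.

Fact reduction_1neq0 : reduce 1 != 0.
Proof.
have [j [k]] := faithful_coord c m fA; apply: contraNneq => r1.
have /reduce_eq : reduce 1 = reduce 0 by rewrite r1 reduce0.
move=> v1; suff : res_coord (1 * coord_basis j) = 0.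
  by rewrite mul1r => /rowP/(_ k)/eqP; rewrite !mxE residue_eq0.
by apply: res_coord0M; rewrite v1 /res_coord linear0 map_mx0.
Qed.

HB.instance Definition _ := GRing.Zmodule_isNzRing.Build B
  reduction_mulA reduction_mul1 reduction_mulr1 reduction_mulDl reduction_mulDr
  reduction_1neq0.

Fact reduction_scaleAl (k : K) (t u : B) : k *: (t * u) = k *: t * u.
Proof.
rewrite -(res_liftK k); have [a ->] := reduce_surj t;
  have [b ->] := reduce_surj u.
by rewrite -reduceZ -[LHS]/(_ *: reduction_mul _ _) -[RHS]/(reduction_mul _ _)
  -!reduce_mul -reduceZ scalerAl.
Qed.

HB.instance Definition _ := GRing.Lmodule_isLalgebra.Build K B
  reduction_scaleAl.

Fact reduction_scaleAr (k : K) (t u : B) : k *: (t * u) = t * (k *: u).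
Proof.
rewrite -(res_liftK k); have [a ->] := reduce_surj t;
  have [b ->] := reduce_surj u.
by rewrite -reduceZ -[LHS]/(_ *: reduction_mul _ _) -[RHS]/(reduction_mul _ _)
  -!reduce_mul -reduceZ scalerAr.
Qed.

HB.instance Definition _ := GRing.Lalgebra_isAlgebra.Build K B
  reduction_scaleAr.
HB.instance Definition _ := Algebra_isFalgebra.Build K B.

Lemma reduceM a b : reduce (a * b) = reduce a * reduce b.
Proof. exact: reduce_mul. Qed.

Lemma reduce1 : reduce 1 = 1. Proof. by []. Qed.

Lemma reduce_sum (I : Type) (s : seq I) (P : pred I) (F : I -> A) :
  reduce (\sum_(j <- s | P j) F j) = \sum_(j <- s | P j) reduce (F j).
Proof. exact: (big_morph _ reduceD reduce0). Qed.

Lemma reduce_eq0 a : (reduce a = 0) <-> (forall j, i a 0 j \in m).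
Proof.
rewrite -reduce0 reduce_eq {2}/res_coord linear0 map_mx0.
split=> [/rowP a0 j|a0]; first by have /eqP := a0 j; rewrite !mxE residue_eq0.
by apply/rowP => j; apply/eqP; rewrite !mxE residue_eq0.
Qed.

(** No lift of h is needed: A represents the scalar maps given by the coordinates, and multiplying
    their left factors by the values of h on the reduced generators assembles h. *)
Lemma reduction_sandwich_full : sandwich_full A -> sandwich_full B.
Proof.
move=> A_full h.
have /choice[s sP] (j : 'I_n) : exists s : seq (A * A),
    forall x, (i x 0 j)%:A = \sum_(w <- s) w.1 * x * w.2.
  pose f x : A := (i x 0 j)%:A.
  have fl : linear f by move=> a x y; rewrite /f linearP !mxE scalerDl scalerA.
  exact: (A_full (to_linear fl)).
exists [seq (h (reduce (coord_basis j)) * reduce w.1, reduce w.2) |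
  j <- enum 'I_n, w <- s j] => t.
have [x ->] := reduce_surj t.
rewrite {1}(coord_expand c x) reduce_sum linear_sum big_allpairs_dep /=
  big_enum /=.
apply: eq_bigr => j _; rewrite reduceZ linearZ /=.
transitivity (h (reduce (coord_basis j)) * reduce ((i x 0 j)%:A)).
  by rewrite reduceZ reduce1 -scalerAr mulr1.
rewrite sP reduce_sum mulr_sumr; apply: eq_bigr => w _.
by rewrite !reduceM !mulrA.
Qed.

Lemma reduction_op_rank (h : {linear A -> A}) (hB : {linear B -> B}) :
  (forall x, reduce (h x) = hB (reduce x)) ->
  op_rank c m h = \dim (limg (linfun hB)).
Proof.
move=> hE; rewrite /op_rank -dim_limg_mulmxr.
set M := residue_mx m _.
have hM a : res_coord (h a) = res_coord a *m M.
  by rewrite -map_mxM mul_rV_lin1 /= cmapK.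
pose vL := linfun (vsval : {linear subvs_of reduction_space -> 'rV[K]_n}).
have vLE t : vL t = vsval t by rewrite lfunE.
have vL0 : lker vL == 0%VS.
  by apply/lker0P => t u; rewrite !vLE => /val_inj.
pose hBL : 'End(subvs_of reduction_space) := linfun hB.
have hBE (t : B) : hBL t = hB t by rewrite lfunE.
rewrite -[RHS](@limg_dim_eq _ _ _ vL (limg hBL)); last first.
  by rewrite (eqP vL0) capv0.
congr (\dim _); apply/vspaceP => u; apply/memv_imgP/memv_imgP.
  move=> [w _ ->]; rewrite lfunE /=.
  pose a := r (map_mx res_lift w).
  have wE : residue_mx m (map_mx res_lift w) = w.
    by apply/matrixP => j k; rewrite !mxE res_liftK.
  exists (hBL (reduce a)); first by rewrite memv_img ?memvf.
  rewrite vLE hBE -hE val_reduce -{1}wE -map_mxM mul_rV_lin1 /=.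
  by [].
move=> [_ /memv_imgP[t _ ->] ->]; have [a aE] := reduce_surj t.
exists (res_coord a); rewrite ?memvf // vLE aE hBE -hE val_reduce hM.
by rewrite lfunE.
Qed.

Lemma reduction_hom_space (e g : A) :
  op_rank c m (sandwich_fun e g) = \dim (hom_space (reduce e) (reduce g)).
Proof.
apply: (reduction_op_rank (h := sandwich_fun e g)) => x.
by rewrite /= /sandwich_fun !reduceM.
Qed.

End Reduction.

(** * Tensor products and Azumaya algebras *)

Section RetractCoordinates.
Variables (R : comNzRingType) (M N : lmodType R) (c : coordinates M).
Variables (i' : {linear N -> M}) (r' : {linear M -> N}) (i'K : cancel i' r').

Definition retract_coordinates : coordinates N :=
  @Coordinates R N (cdim c) (cmap c \o i') (r' \o csec c)
    (fun x => etrans (congr1 r' (cmapK c (i' x))) (i'K x)).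

Lemma retract_rk p : rk N p = op_rank c p (i' \o r').
Proof. by rewrite (rkE p (cmapK retract_coordinates)). Qed.

End RetractCoordinates.

Lemma fg_projective_coordinates (R : comNzRingType) (M : lmodType R) :
  fg_projective M -> exists c : coordinates M, True.
Proof. by move=> [n [i [r iK]]]; exists (Coordinates iK). Qed.

Lemma coordinates_fg_projective (R : comNzRingType) (M : lmodType R) :
  coordinates M -> fg_projective M.
Proof. by case=> n i r iK; exists n, i, r. Qed.

Section DualBasis.
Variables (R : comNzRingType) (M : lmodType R) (I : finType).
Variables (e : I -> M) (phi : I -> {linear M -> R^o}).
Hypothesis expand : forall x, x = \sum_k phi k x *: e k.

Let i x : 'rV[R]_#|I| := \row_k phi (enum_val k) x.
Let r (v : 'rV[R]_#|I|) : M := \sum_k v 0 (enum_rank k) *: e k.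

Let i_linear : linear i.
Proof. by move=> a x y; apply/rowP => k; rewrite !mxE linearP. Qed.
Let r_linear : linear r.
Proof.
move=> a x y; rewrite /r scaler_sumr -big_split; apply: eq_bigr => k _ /=.
by rewrite !mxE scalerDl scalerA.
Qed.
Let iK : cancel i r.
Proof.
move=> x; rewrite [RHS]expand /r; apply: eq_bigr => k _.
by rewrite mxE enum_rankK.
Qed.

Definition dual_coordinates : coordinates M :=
  @Coordinates R M #|I| (to_linear i_linear) (to_linear r_linear) iK.

End DualBasis.

Section TensorProduct.
Variables (R : comNzRingType) (M N T : lmodType R).
Variables (cM : coordinates M) (cN : coordinates N) (b : M -> N -> T).
Local Notation mi := (cmap cM).
Local Notation ni := (cmap cN).

Definition tensor_span t := exists s : seq (M * N), t = \sum_(w <- s) b w.1 w.2.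

Lemma tensor_span_sum (I : Type) (s : seq I) (P : pred I) (F : I -> T) :
  (forall j, P j -> tensor_span (F j)) -> tensor_span (\sum_(j <- s | P j) F j).
Proof.
move=> FP; apply: (big_ind tensor_span) => //; first by exists [::];
  rewrite big_nil.
by move=> _ _ [s1 ->] [s2 ->]; exists (s1 ++ s2); rewrite big_cat.
Qed.

Lemma tensor_span1 x y : tensor_span (b x y).
Proof. by exists [:: (x, y)]; rewrite big_seq1. Qed.

Lemma bilinear_expand (V : lmodType R) (f : M -> N -> V) x y :
  bilinear_for *:%R *:%R f ->
  f x y = \sum_j \sum_k (mi x 0 j * ni y 0 k) *: f (coord_basis j) (coord_basis
    k).
Proof.
move=> [fl fr]; rewrite {1}(coord_expand cM x).
rewrite (linear_sumZ (f := f^~ y) _ _ _ _ (fl y)) /=; apply: eq_bigr => j _.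
rewrite {1}(coord_expand cN y) (linear_sumZ _ _ _ _ (fr _)) scaler_sumr.
by apply: eq_bigr => k _; rewrite scalerA.
Qed.

(** The forms l define the map induced by a bilinear f through its values on generators, and
    spanning gives uniqueness. No injectivity has to be checked. *)
Lemma tensor_criterion (l : 'I_(cdim cM) -> 'I_(cdim cN) -> {linear T -> R^o}) :
  bilinear_for *:%R *:%R b ->
  (forall t, tensor_span t) ->
  (forall j k x y, l j k (b x y) = mi x 0 j * ni y 0 k) ->
  is_tensor_product b.
Proof.
move=> bl span lE; split=> // V f fl.
pose g t := \sum_j \sum_k l j k t *: f (coord_basis j) (coord_basis k).
have gl : linear g.
  move=> a x y; rewrite /g scaler_sumr -big_split; apply: eq_bigr => j _ /=.
  rewrite scaler_sumr -big_split; apply: eq_bigr => k _ /=.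
  by rewrite linearP scalerDl scalerA.
have gE x y : g (b x y) = f x y.
  rewrite [RHS]bilinear_expand //; apply: eq_bigr => j _; apply: eq_bigr => k _.
  by rewrite lE.
exists g; split=> // g' [g'l g'E]; apply/funext => t; have [s ->] := span t.
rewrite !linear_sumP //; apply: eq_bigr => w _.
by rewrite gE g'E.
Qed.

(** The forms come from the universal property applied to products of coordinates. The expansion is
    a linear map fixing pure tensors, hence the identity by uniqueness. *)
Lemma tensor_expand : is_tensor_product b ->
  exists l : 'I_(cdim cM) -> 'I_(cdim cN) -> {linear T -> R^o},
    (forall j k x y, l j k (b x y) = mi x 0 j * ni y 0 k) /\
    forall t, t = \sum_j \sum_k l j k t *: b (coord_basis j) (coord_basis k).
Proof.
move=> [bl univ].
have exl j k : exists l : {linear T -> R^o},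
    forall x y, l (b x y) = mi x 0 j * ni y 0 k.
  have [|g [[gl gE] _]] := univ R^o (fun x y => mi x 0 j * ni y 0 k).
    split=> [y|x] a u v /=; first by rewrite linearP !mxE mulrDl -mulrA.
    by rewrite linearP !mxE mulrDr mulrCA.
  by exists (to_linear gl).
have exl' j : exists l : 'I_(cdim cN) -> {linear T -> R^o},
    forall k x y, l k (b x y) = mi x 0 j * ni y 0 k.
  by have [l lE] := choice (exl j); exists l.
have [l lE] := choice exl'.
exists l; split=> // t.
pose g t := \sum_j \sum_k l j k t *: b (coord_basis j) (coord_basis k).
have gl : linear g.
  move=> a x y; rewrite /g scaler_sumr -big_split; apply: eq_bigr => j _ /=.
  rewrite scaler_sumr -big_split; apply: eq_bigr => k _ /=.
  by rewrite linearP scalerDl scalerA.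
have gE x y : g (b x y) = b x y.
  rewrite [RHS]bilinear_expand //; apply: eq_bigr => j _; apply: eq_bigr => k _.
  by rewrite lE.
have [h [_ uniq]] := univ T b bl.
have := uniq g (conj gl gE); have := uniq id; rewrite /= => -> //.
by move=> E; rewrite -[RHS]/(g t) -E.
Qed.

End TensorProduct.

Section SandwichFull.
Variables (R : comNzRingType) (A : algType R).

Lemma end_app_sumZ (P : lmodType R) (fP : faithful P) (I : Type) (s : seq I)
    (Q : pred I) (a : I -> R) (F : I -> end_alg fP) x :
  end_app (\sum_(j <- s | Q j) a j *: F j) x =
  \sum_(j <- s | Q j) a j *: end_app (F j) x.
Proof.
exact: (@linear_sumZ R (end_alg fP) P (fun f => end_app f x) I s Q a F).
Qed.

Lemma end_app_sum (P : lmodType R) (fP : faithful P) (I : Type) (s : seq I)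
    (Q : pred I) (F : I -> end_alg fP) x :
  end_app (\sum_(j <- s | Q j) F j) x = \sum_(j <- s | Q j) end_app (F j) x.
Proof.
apply: (@linear_sumP R (end_alg fP) P (fun f => end_app f x) I s Q F).
by move=> a f g.
Qed.

Lemma sandwich_bilinear (fA : faithful A) :
  bilinear_for *:%R *:%R (@sandwich R A fA).
Proof.
split=> [v|u] a x y; apply: end_alg_ext => z /=.
  by rewrite -[LHS]/(_ * z * v) !mulrDl -!scalerAl.
by rewrite -[LHS]/(u * z * _) mulrDr -scalerAr.
Qed.

Lemma azumaya_sandwich_full : azumaya A -> sandwich_full A.
Proof.
move=> [/fg_projective_coordinates[c _] [fA tA]] h.
have [l [lE ex]] := tensor_expand c c tA.
exists [seq (l jk.1 jk.2 (h : end_alg fA) *: coord_basis jk.1, coord_basis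
  jk.2) |
  jk <- [seq (j, k) | j <- enum 'I_(cdim c), k <- enum 'I_(cdim c)]] => x.
rewrite big_map big_allpairs_dep /= big_enum /=.
rewrite -[LHS]/(end_app (h : end_alg fA) x) {1}(ex h) end_app_sum.
apply: eq_bigr => j _; rewrite end_app_sumZ big_enum; apply: eq_bigr => k _ /=.
by rewrite -!scalerAl.
Qed.

End SandwichFull.

(** * Corners and right ideals as direct summands of A *)

Section CornerModules.
Variables (R : comNzRingType) (A : algType R) (c : coordinates A).
Variables (e : A) (eI : e * e = e) (e0 : e != 0).
Local Notation eAe := (corner eI e0).

Lemma cornerP (x : eAe) : e * val x = val x /\ val x * e = val x.
Proof.
case: x => x /= /asboolP[a ->]; split; first by rewrite !mulrA eI.
by rewrite -!mulrA eI.
Qed.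

Fact corner_proj_subproof (a : A) : corner_pred e (e * a * e).
Proof. by apply/asboolP; exists a. Qed.

Definition corner_proj (a : A) : eAe := Corner _ _ (corner_proj_subproof a).

Lemma corner_proj_linear : linear corner_proj.
Proof.
by move=> r x y; apply: val_inj; rewrite /= mulrDr mulrDl -scalerAr -scalerAl.
Qed.

Lemma corner_valK : cancel val corner_proj.
Proof.
by move=> x; apply: val_inj; have [ex xe] := cornerP x; rewrite /= ex xe.
Qed.

Definition corner_inj : {linear eAe -> A} := val.

Definition corner_coordinates : coordinates eAe :=
  @retract_coordinates R A eAe c corner_inj (to_linear corner_proj_linear)
    corner_valK.

Lemma corner_rk p : rk eAe p = op_rank c p (sandwich_fun e e).
Proof. exact: (@retract_rk R A eAe c corner_inj (to_linear corner_proj_linear)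
  corner_valK). Qed.

Lemma right_ideal_retract : exists (i' : {linear restr (right_ideal e) -> A})
    (r' : {linear A -> restr (right_ideal e)}),
  cancel i' r' /\ forall a, i' (r' a) = e * a.
Proof.
pose f (x : restr (right_ideal e)) : A := right_ideal_val (x : right_ideal e).
have fl : linear f.
  move=> r x y; rewrite /f /= -[LHS]/(right_ideal_val x * r%:A +
    right_ideal_val y).
  by rewrite -scalerAr mulr1.
have gP (a : A) : right_ideal_pred e (e * a) by apply/asboolP; exists a.
pose g (a : A) : restr (right_ideal e) := RightIdeal (gP a).
have gl : linear g.
  move=> r x y; apply: val_inj; rewrite /= -[RHS]/(e * x * r%:A + e * y).
  by rewrite -scalerAr mulr1 mulrDr -scalerAr.
exists (to_linear fl), (to_linear gl); split=> // x.
apply: val_inj; case: x => x /= xP; rewrite /f /=.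
by case/asboolP: xP => a ->; rewrite mulrA eI.
Qed.

Lemma right_ideal_projective : fg_projective (restr (right_ideal e)).
Proof.
have [i' [r' [i'K _]]] := right_ideal_retract.
exact: coordinates_fg_projective (retract_coordinates c i'K).
Qed.

Lemma right_ideal_rk p :
  rk (restr (right_ideal e)) p = op_rank c p (sandwich_fun e 1).
Proof.
have [i' [r' [i'K i'r']]] := right_ideal_retract.
rewrite (retract_rk c i'K); congr (op_rank c p _); apply/funext => x.
by rewrite /sandwich_fun mulr1 -i'r'.
Qed.

(** Extend an endomorphism h of e A e to A by composing with a -> e a e, expand it in A (x) A^op,
    and compress all tensor factors by e. *)
Lemma corner_azumaya : azumaya A -> faithful eAe -> azumaya eAe.
Proof.
move=> [_ [fA tA]] fE; split.
  exact: coordinates_fg_projective corner_coordinates.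
exists fE.
have [l [lE ex]] := tensor_expand c c tA.
pose ext (h : end_alg fE) : {linear A -> A} :=
  corner_inj \o (h : {linear eAe -> eAe}) \o to_linear corner_proj_linear.
pose l' j k (h : end_alg fE) : R^o := l j k (ext h : end_alg fA).
have l'l j k : linear (l' j k).
  move=> r g h; rewrite /l' -linearP; congr (l j k _).
  exact: end_alg_ext.
apply: (@tensor_criterion R eAe eAe (end_alg fE) corner_coordinates
  corner_coordinates
  (@sandwich R eAe fE) (fun j k => to_linear (l'l j k))).
- exact: sandwich_bilinear.
- move=> h.
  have -> : h = \sum_j \sum_k sandwich fE
      ((l j k (ext h : end_alg fA) : R) *: corner_proj (coord_basis j))
        (corner_proj (coord_basis k)).
    apply: end_alg_ext => x; apply: val_inj.
    have [ex' xe] := cornerP x.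
    have hE : val (end_app h x) = e * end_app (ext h : end_alg fA) (val x) * e.
      have [hl hr] := cornerP (end_app h x).
      rewrite -[end_app (ext h) _]/(val (end_app h (corner_proj (val x)))).
      by rewrite corner_valK hl hr.
    rewrite hE {1}(ex (ext h)) !end_app_sum.
    rewrite mulr_sumr mulr_suml [RHS](linear_sum corner_inj);
      apply: eq_bigr => j _.
    rewrite end_app_sumZ end_app_sum mulr_sumr mulr_suml [RHS](linear_sum
      corner_inj).
    apply: eq_bigr => k _.
    rewrite -[RHS]/((l j k _ *: (e * coord_basis j * e)) * val x * (e *
      coord_basis k * e)).
    rewrite -[end_app _ _]/(coord_basis j * val x * coord_basis k).
    rewrite -!scalerAl -scalerAr -scalerAl; congr (_ *: _).
    by rewrite !mulrA -(mulrA _ e (val x)) ex' -(mulrA _ (val x) e) xe.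
  by do 2! (apply: tensor_span_sum => ? _); apply: tensor_span1.
- move=> j k u v /=; rewrite -lE; congr (l j k _).
  apply: end_alg_ext => x.
  have [eu ue] := cornerP u; have [ev ve] := cornerP v.
  rewrite -[LHS]/(val u * (e * x * e) * val v) -[RHS]/(val u * x * val v).
  by rewrite !mulrA ue -mulrA ev.
Qed.

End CornerModules.

(** * Idempotents over a semilocal ring *)

Section Semilocal.
Variables (R : comNzRingType) (S : maximal_spectrum R).
Variables (A : algType R) (c : coordinates A).
Hypotheses (A_full : sandwich_full A) (fA : faithful A).
Local Notation n := (cdim c).
Local Notation m := (@max_ideal R S).
Local Notation red i := (@reduce R A c (m i) (max_idealP i) fA).
Implicit Types (e f g x y : A).

(** The rank of left multiplication by e; for idempotent e, the rank of the right ideal e A. *)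
Definition left_rank i e : nat := op_rank c (m i) (sandwich_fun e 1).

Lemma left_rankE i e : left_rank i e = \dim (hom_space (red i e) 1).
Proof. by rewrite /left_rank (@reduction_hom_space _ _ _ _ (max_idealP i) fA)
  reduce1. Qed.

Lemma hom_space1P (K : fieldType) (B : falgType K) (e z : B) :
  reflect (exists b, z = e * b) (z \in hom_space e 1).
Proof.
apply: (iffP memv_imgP) => [[b _ ->]|[b ->]]; exists b;
  rewrite ?memvf ?lfunE //=.
  by rewrite /sandwich_fun mulr1.
by rewrite /sandwich_fun mulr1.
Qed.

Lemma left_rank_eq0 i e : (left_rank i e == 0%N) = (red i e == 0).
Proof.
rewrite left_rankE dimv_eq0; apply/eqP/eqP => [e0|->].
  by apply/eqP; rewrite -memv0 -e0; apply/hom_space1P; exists 1; rewrite mulr1.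
apply/eqP; rewrite -subv0; apply/subvP => z /hom_space1P[b ->].
by rewrite mul0r mem0v.
Qed.

Lemma left_rankMl i x y : (left_rank i (x * y) <= left_rank i x)%N.
Proof.
rewrite !left_rankE; apply/dimvS/subvP => z /hom_space1P[b ->].
by apply/hom_space1P; exists (red i y * b); rewrite reduceM mulrA.
Qed.

Lemma left_rankMr i x y : (left_rank i (x * y) <= left_rank i y)%N.
Proof.
rewrite !left_rankE.
have -> : hom_space (red i (x * y)) 1 = (amull (red i x) @: hom_space (red i y)
  1%R)%VS.
  apply/vspaceP => z; apply/hom_space1P/memv_imgP.
    move=> [b ->]; exists (red i y * b); first by apply/hom_space1P; exists b.
    by rewrite lfunE /= reduceM mulrA.
  move=> [_ /hom_space1P[b ->] ->]; exists b.
  by rewrite lfunE /= reduceM mulrA.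
by rewrite -[X in (_ <= X)%N](limg_ker_dim (amull (red i x))) leq_addl.
Qed.

Lemma left_rank_red i x y : red i x = red i y -> left_rank i x = left_rank i y.
Proof. by rewrite !left_rankE => ->. Qed.

(** Modulo the i-th ideal, fA lies in eA and has at least its dimension, so the two agree and f
    fixes e. *)
Lemma left_rank_eq i e f : e * f = f -> (left_rank i e <= left_rank i f)%N ->
  f * f = f -> red i (f * e) = red i e.
Proof.
move=> ef le ff.
have sub : (hom_space (red i f) 1%R <= hom_space (red i e) 1%R)%VS.
  apply/subvP => z /hom_space1P[b ->]; apply/hom_space1P.
  by exists (red i f * b); rewrite mulrA -reduceM ef.
have /eqP E : hom_space (red i f) 1 == hom_space (red i e) 1.
  by rewrite eqEdim sub -!left_rankE.
have : red i e \in hom_space (red i f) 1.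
  by rewrite E; apply/hom_space1P; exists 1; rewrite mulr1.
by case/hom_space1P => b eb; rewrite reduceM eb mulrA -reduceM ff.
Qed.

Lemma unit_mod_all z : (forall i, red i z = 1) -> exists w, z * w = 1.
Proof.
move=> z1; pose L : {linear A -> A} := sandwich_fun z 1.
have LE x : L x = z * x by rewrite /L /= /sandwich_fun mulr1.
pose Y := lin1_mx (cmap c \o L \o csec c).
(* Left multiplication by z, completed by the identity on the complement of A in the free module. It
   is the identity modulo every maximal ideal, so its determinant is a unit. *)
pose X := Y + (1%:M - coord_proj c).
have YE v : v *m Y = cmap c (L (csec c v)) by rewrite mul_rV_lin1.
have PE v : v *m coord_proj c = cmap c (csec c v) by rewrite mul_rV_lin1.
have [y yX] : exists u : R, u * \det X = 1.
  apply: (unit_mod_max (S := S)) => i; rewrite -residue_eq0 residue_det.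
  suff -> : residue_mx (m i) X = 1%:M by rewrite det1 oner_neq0.
  rewrite map_mxD map_mxB map_mx1 addrCA -[RHS]addr0; congr (_ + _).
  apply/eqP; rewrite subr_eq0; apply/eqP.
  apply/row_matrixP => j; rewrite -!map_row !rowE YE PE LE.
  apply/(@reduce_eq R A c (m i) (max_idealP i) fA (z * csec c (delta_mx 0 j))
    (csec c (delta_mx 0 j))).
  by rewrite reduceM z1 mul1r.
pose v := cmap c 1 *m (y *: \adj X).
have vX : v *m X = cmap c 1.
  by rewrite -mulmxA -scalemxAl mul_adj_mx scale_scalar_mx yX mulmx1.
have vP : v *m coord_proj c = v.
  have : v *m X *m (1%:M - coord_proj c) = 0.
    by rewrite vX mulmxBr mulmx1 PE cmapK subrr.
  have PP : coord_proj c *m coord_proj c = coord_proj c.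
    by apply/row_matrixP => j; rewrite !rowE mulmxA !PE cmapK.
  have YP : Y *m coord_proj c = Y.
    by apply/row_matrixP => j; rewrite !rowE mulmxA PE YE cmapK.
  have -> : v *m X *m (1%:M - coord_proj c) = v - v *m coord_proj c.
    rewrite -mulmxA mulmxDl !mulmxBr !mulmx1 YP subrr add0r mulmxBl mul1mx PP.
    by rewrite subrr subr0 mulmxBr mulmx1.
  by move/eqP; rewrite subr_eq0 => /eqP.
exists (csec c v); apply: (can_inj (cmapK c)).
by rewrite -LE -YE -vX mulmxDr mulmxBr mulmx1 vP subrr addr0.
Qed.

Lemma central_structure i : exists (l : nat) (s : A -> nat),
  [/\ (0 < l)%N, (0 < s 1%R)%N,
    forall e f, e * e = e -> f * f = f ->
      op_rank c (m i) (sandwich_fun e f) = (s e * s f * l ^ 2)%N &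
    forall e f, e * e = e -> f * f = f -> (s e <= s f)%N ->
      exists u v, red i (u * f * v) = red i e].
Proof.
have [l [s [l0 s1 sl scmp]]] := central_simple_structure
  (@reduction_sandwich_full R A c (m i) (max_idealP i) fA A_full).
exists l, (fun x => s (red i x)); split=> //.
- move=> e f ee ff; rewrite (@reduction_hom_space _ _ _ _ (max_idealP i) fA).
  by rewrite sl // -reduceM ?ee ?ff.
- move=> e f ee ff; case/(scmp (red i e) (red i f));
  rewrite -?reduceM ?ee ?ff //.
  move=> u [v uv]; have [a aE] := reduce_surj u; have [b bE] := reduce_surj v.
  by exists a, b; rewrite !reduceM -aE -bE.
Qed.

(* Solve the problem modulo every maximal ideal, glue the solutions by the
   Chinese remainder theorem, and correct by an element that is invertible
   because it is 1 modulo every maximal ideal. *)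
Lemma idempotent_embed e f : e * e = e -> f * f = f ->
  (forall i, left_rank i e <= left_rank i f)%N ->
  exists x y, [/\ e * x = x, x * f = x, f * y = y, y * e = y & x * y = e].
Proof.
move=> ee ff le.
have /choice[uv uvP] (i : 'I_(nmax S)) : exists uv : A * A,
    red i (uv.1 * f * uv.2) = red i e.
  have [l [s [l0 s1 sl scmp]]] := central_structure i.
  (* [left_rank i e] is s e * s 1 * l ^ 2; cancelling the positive factors s 1 and l ^ 2 turns the
     hypothesis on ranks into the comparison of s. *)
  have [|u [v uvE]] := scmp e f ee ff; last by exists (u, v).
  move: (le i); rewrite /left_rank !sl ?mulr1 // leq_pmul2r ?expn_gt0 ?l0 //.
  by rewrite leq_pmul2r.
have [d dE] := chinese S.
have redsum (a : 'I_(nmax S) -> A) i : red i (\sum_j d j *: a j) = red i (a i).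
  rewrite reduce_sum (bigD1 i) //= big1 ?addr0 => [|j ji].
    by rewrite reduceZ dE eqxx scale1r.
  by rewrite reduceZ dE eq_sym (negPf ji) scale0r.
pose u := \sum_j d j *: (uv j).1; pose v := \sum_j d j *: (uv j).2.
pose x := e * u * f; pose z := x * v * e.
have ez : e * z = z by rewrite /z /x !mulrA ee.
have [w zw] : exists w, (z + (1 - e)) * w = 1.
  apply: unit_mod_all => i; rewrite reduceD reduceB reduce1.
  suff -> : red i z = red i e by rewrite addrC subrK.
  have := uvP i; rewrite !reduceM => uvE; rewrite /z /x. rewrite !redsum.
  have assoc (B : nzRingType) (E U F V : B) : E * U * F * V * E = E * (U * F *
    V) * E.
    by rewrite !mulrA.
  have ree : red i e * red i e = red i e by rewrite -reduceM ee.
  by rewrite assoc uvE ree ree.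
have zwe : z * w * e = e.
  transitivity (e * ((z + (1 - e)) * w) * e); last by rewrite zw mulr1 ee.
  by rewrite (mulrA e) mulrDr mulrBr mulr1 ee subrr addr0 ez.
exists x, (f * v * e * w * e); split.
- by rewrite /x !mulrA ee.
- by rewrite /x -mulrA ff.
- by rewrite !mulrA ff.
- by rewrite -mulrA ee.
- by rewrite -[RHS]zwe /z !mulrA -(mulrA _ f f) ff.
Qed.

(** Products of the Goldman idempotents for e and for f are orthogonal idempotents indexed by pairs
    of ranks in 0..n. Summing over the pairs in increasing order selects the part where the
    comparison holds. *)
Lemma left_rank_idempotent e f : e * e = e -> f * f = f ->
  exists2 eps : R, eps * eps = eps &
    forall i, residue (m i) eps = (left_rank i e <= left_rank i f)%N%:R.
Proof.
move=> ee ff.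
pose P x := lin1_mx (cmap c \o sandwich_fun x 1 \o csec c).
have PP x : x * x = x -> P x *m P x = P x.
  move=> xx; apply/row_matrixP => j; rewrite !rowE mulmxA !mul_rV_lin1 /= cmapK.
  by rewrite /sandwich_fun !mulr1 mulrA xx.
pose E (p : 'I_n.+1 * 'I_n.+1) :=
  (rank_poly (P e))`_p.1 * (rank_poly (P f))`_p.2.
have EE p q : E p * E q = E p *+ (p == q).
  case: p q => [a b] [a' b'].
  rewrite /E mulrACA !rank_poly_orthogonal ?PP // mulrnAr mulrnAl -mulrnA mulnb.
  by rewrite xpair_eqE -!val_eqE.
exists (\sum_(p : 'I_n.+1 * 'I_n.+1 | (p.1 <= p.2)%N) E p).
  rewrite mulr_suml; apply: eq_bigr => p le_p.
  rewrite mulr_sumr (bigD1 p) //= EE eqxx big1 ?addr0 // => q /andP[_ qp].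
  by rewrite EE eq_sym (negPf qp).
move=> i; rewrite residue_sum.
have lt_rank x : (left_rank i x < n.+1)%N by rewrite ltnS /left_rank /op_rank
  rank_leq_row.
have resE p : residue (m i) (E p) =
    (p == (Ordinal (lt_rank e), Ordinal (lt_rank f)))%:R.
  rewrite residueM !rank_poly_residue ?PP // -natrM mulnb.
  by case: p => a b; rewrite xpair_eqE -!val_eqE.
under eq_bigr do rewrite resE.
rewrite big_mkcond (bigD1 (Ordinal (lt_rank e), Ordinal (lt_rank f))) //= eqxx.
rewrite big1 ?addr0 => [|p pn]; first by case: ifP.
by rewrite (negPf pn); case: ifP.
Qed.

Definition full e := forall i, red i e != 0.

Definition minimal_full e := [/\ e * e = e, full e &
  forall f, f * f = f -> e * f = f -> f * e = f -> full f -> f = e].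

(** All ranks of e are 0, so e factors through the idempotent 0. *)
Lemma red_idempotent_eq0 e : e * e = e -> (forall i, red i e = 0) -> e = 0.
Proof.
move=> ee e0; have [|x [y [_ x0 _ _ <-]]] := @idempotent_embed e 0 ee (mulr0 0).
  by move=> i; have := left_rank_eq0 i e; rewrite e0 eqxx => /eqP ->.
by rewrite -x0 mulr0 mul0r.
Qed.

(** Minimise the sum of the local ranks. A full f below e then has the same rank everywhere, so the
    idempotent e - f vanishes modulo every maximal ideal. *)
Lemma minimal_full_exists : exists e, minimal_full e.
Proof.
pose mu e := (\sum_i left_rank i e)%N.
pose P k := `[< exists e, [/\ e * e = e, full e & mu e = k] >].
have exP : exists k, P k.
  exists (mu 1); apply/asboolP; exists 1; split; rewrite ?mulr1 //.
  by move=> i; rewrite reduce1 oner_neq0.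
case: (ex_minnP exP) => k /asboolP[e [ee efull <-]] min.
exists e; split=> // f ff ef fe ffull.
have le i : (left_rank i f <= left_rank i e)%N by rewrite -ef left_rankMl.
have eq_rank i : left_rank i f = left_rank i e.
  apply/eqP; rewrite eqn_leq le leqNgt; apply/negP => lt.
  have /min : P (mu f) by apply/asboolP; exists f.
  rewrite leqNgt => /negP; apply;
    rewrite /mu (bigD1 i) //= [X in (_ < X)%N](bigD1 i) //=.
  by rewrite -addSn leq_add // leq_sum.
apply/esym/eqP; rewrite -subr_eq0; apply/eqP; apply: red_idempotent_eq0.
  by rewrite mulrBr !mulrBl ee ef fe ff subrr subr0.
move=> i; rewrite reduceB; apply/eqP; rewrite subr_eq0; apply/eqP/esym.
by rewrite -fe; apply: left_rank_eq; rewrite ?eq_rank.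
Qed.

(* Where the rank of g is at least that of e, split off a copy of e from g. If
   this happens nowhere but g != 0, replacing e by a copy of g on the part of
     the
   spectrum where g is nonzero contradicts the minimality of e. *)
Lemma minimal_decomposition e g : minimal_full e -> g * g = g ->
  exists k (f : 'I_k -> R) (x y : 'I_k -> A),
    (forall j, f j * f j = f j) /\ decomposition e g f x y.
Proof.
move=> [ee efull emin].
have [N] := ubnP (\sum_i left_rank i g)%N; elim: N => // N IH in g *.
rewrite ltnS => leN gg.
have [eps epseps epsE] := left_rank_idempotent ee gg.
have [[i1 le1]|small] := pselect (exists i, (left_rank i e <= left_rank i g)%N).
  (* eps is 1 where e fits into g and 0 elsewhere, so eps e embeds in g at every maximal ideal. *)
  have ee' : eps *: e * (eps *: e) = eps *: e.
    by rewrite -scalerAl -scalerAr scalerA epseps ee.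
  have [|y [x [ey yg gx xe yx]]] := @idempotent_embed (eps *: e) g ee' gg.
    move=> i; have := epsE i; case: leqP => [le|lt] E.
      by rewrite (@left_rank_red i _ e) ?le // reduceZ E scale1r.
    by have := left_rank_eq0 i (eps *: e);
      rewrite reduceZ E scale0r eqxx => /eqP ->.
  have epsx : eps *: x = x by rewrite -xe -scalerAr scalerA epseps.
  have epsy : eps *: y = y by rewrite -ey -scalerAl scalerA epseps.
  have xe1 : x * e = x by rewrite -{1}epsx -scalerAl scalerAr xe.
  have ey1 : e * y = y by rewrite -{1}epsy -scalerAr scalerAl ey.
  have [h hE] : exists h, h = x * y by exists (x * y).
  have hx : h * x = x by rewrite hE -mulrA yx xe.
  have hh : h * h = h by rewrite {2}hE mulrA hx.
  have gh : g * h = h by rewrite hE mulrA gx.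
  have hg : h * g = h by rewrite hE -mulrA yg.
  have g'g' : (g - h) * (g - h) = g - h.
    by rewrite mulrBr !mulrBl gg gh hg hh subrr subr0.
  have gg' : g * (g - h) = g - h by rewrite mulrBr gg gh.
  have le i : (left_rank i (g - h) <= left_rank i g)%N by rewrite -gg'
    left_rankMl.
  (* If the rank did not drop, h and hence eps e = y x would vanish at i1, where eps is 1 and e is
     nonzero. *)
  have lt1 : (left_rank i1 (g - h) < left_rank i1 g)%N.
    rewrite ltnNge; apply/negP => ge; case/eqP: (efull i1).
    have /left_rank_eq : g * (g - h) = g - h by [].
    move=> /(_ i1 ge g'g'); rewrite mulrBl gg hg => rE.
    have : red i1 h = 0.
      have := congr1 (fun t => red i1 h * t) rE.
      by rewrite -!reduceM mulrBr hg hh subrr => <-; rewrite reduce0.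
    move=> h0; have := epsE i1; rewrite le1 => eps1.
    have : red i1 (eps *: e) = 0 by rewrite -yx -hx !reduceM h0 mul0r mulr0.
    by rewrite reduceZ eps1 scale1r.
  have [|k [f [x' [y' [fI dec]]]]] := IH (g - h) _ g'g'.
    apply: leq_trans leN; rewrite (bigD1 i1) //= [X in (_ < X)%N](bigD1 i1) //=.
    by rewrite -addSn leq_add // leq_sum.
  exists k.+1, (fun j => oapp f eps (unlift ord0 j)), (fun j =>
    oapp x' x (unlift ord0 j)),
    (fun j => oapp y' y (unlift ord0 j)).
  split; first by move=> j; case: unlift => [j'|] /=.
  by apply: decomposition_cons; rewrite -?hE.
have lt i : (left_rank i g < left_rank i e)%N.
  by rewrite ltnNge; apply/negP => le; apply: small; exists i.
have [g0|[i1 i1g]] : g = 0 \/ exists i, red i g != 0.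
    have [ex|nex] := pselect (exists i, red i g != 0); [by right|left].
    apply: red_idempotent_eq0 => // i; apply: contrapT => /eqP gi.
    by apply: nex; exists i.
  exists 0%N, (fun=> 0), (fun=> 0), (fun=> 0); split; first by case.
  by rewrite g0; apply: decomposition0.
have [|x [y [gx xe ey yg xy]]] := @idempotent_embed g e gg ee.
  by move=> i; apply: ltnW.
have [q qE] : exists q, q = y * x by exists (y * x).
have qq : q * q = q by rewrite qE mulrA -(mulrA y) xy -mulrA gx.
have eq : e * q = q by rewrite qE mulrA ey.
have qe : q * e = q by rewrite qE -mulrA xe.
(* Comparing g with 0 gives an idempotent of R that is 1 exactly where g vanishes. *)
have [d dd dE] := left_rank_idempotent gg (mulr0 0).
have dE' i : residue (m i) d = (red i g == 0)%:R.
  rewrite dE -left_rank_eq0; congr (_%:R).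
  have := left_rank_eq0 i 0; rewrite reduce0 eqxx => /eqP ->.
  by rewrite leqn0.
(* e where g vanishes, and the copy q of g inside e elsewhere. This is full, so f = e by minimality,
   and at i1 the rank of e is at most that of g. *)
pose f := d *: e + (1 - d) *: q.
have dd' : d * (1 - d) = 0 by rewrite mulrBr mulr1 dd subrr.
have d'd' : (1 - d) * (1 - d) = 1 - d by rewrite mulrBl mul1r dd' subr0.
have redf i : red i f = if red i g == 0 then red i e else red i q.
  rewrite reduceD !reduceZ residueB dE'; case: ifP => _.
    by rewrite scale1r rmorph1 subrr scale0r addr0.
  by rewrite scale0r rmorph1 subr0 scale1r add0r.
have redq i : red i q = 0 -> red i g = 0.
  by move=> q0; rewrite -gg -xy mulrA -(mulrA x) -qE !reduceM q0 mulr0 mul0r.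
have fE : f = e.
  apply: emin.
  - rewrite mulrDl !mulrDr -!scalerAl -!scalerAr !scalerA dd dd' (mulrC _ d)
    dd'.
    by rewrite !scale0r addr0 add0r ee qq d'd'.
  - by rewrite mulrDr -!scalerAr ee eq.
  - by rewrite mulrDl -!scalerAl ee qe.
  - move=> i; rewrite redf; case: (red i g =P 0) => [_|gi]; first exact: efull.
    by apply/eqP => /redq.
have := lt i1; rewrite ltnNge => /negP; case.
have -> : left_rank i1 e = left_rank i1 q.
  by apply: left_rank_red; rewrite -fE redf (negPf i1g).
have -> : q = y * (g * x) by rewrite gx.
exact: leq_trans (left_rankMr _ _ _) (left_rankMl _ _ _).
Qed.

(** Each f_j reduces to 0 or 1, and its summand to 0 or a full copy of eA; k' counts the copies that
    survive. *)
Lemma decomposition_rank i e g k (f : 'I_k -> R) (x y : 'I_k -> A) :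
  e * e = e -> g * g = g -> (forall j, f j * f j = f j) ->
  decomposition e g f x y ->
  exists k', op_rank c (m i) (sandwich_fun g g) =
    (k' ^ 2 * op_rank c (m i) (sandwich_fun e e))%N.
Proof.
move=> ee gg ff [gx xe ey yx xy].
pose J := [set j | residue (m i) (f j) == 1].
have f01 j : j \notin J -> residue (m i) (f j) = 0.
  rewrite inE => f1; have := congr1 (residue (m i)) (ff j).
  move=> /eqP; rewrite residueM -subr_eq0 -{3}[residue _ _]mulr1 -mulrBr
    mulf_eq0.
  by rewrite subr_eq0 (negPf f1) orbF => /eqP.
exists #|J|; rewrite !(@reduction_hom_space _ _ _ _ (max_idealP i) fA).
pose x' (j : 'I_#|J|) := red i (x (enum_val j)).
pose y' (j : 'I_#|J|) := red i (y (enum_val j)).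
have dec : decomposition (red i e) (red i g) (fun _ : 'I_#|J| => 1) x' y'.
  split.
  - by move=> j; rewrite -reduceM gx.
  - by move=> j; rewrite -reduceM xe.
  - by move=> j; rewrite -!reduceM; have [-> ->] := ey (enum_val j).
  - move=> a b; rewrite -reduceM yx reduceZ (inj_eq enum_val_inj).
    have /eqP fa : residue (m i) (f (enum_val a)) == 1.
      by have := enum_valP a; rewrite inE.
    by case: (a == b); rewrite ?mulr1n ?fa // !mulr0n rmorph0.
  - transitivity (\sum_(j in J) red i (x j * y j)).
      by rewrite [RHS]big_enum_val; apply: eq_bigr => j _; rewrite reduceM.
    rewrite -[in RHS]xy reduce_sum [RHS](bigID (mem J)) /= [X in _ + X]big1
      ?addr0 //.
    move=> j /f01 fj; suff xj : red i (x j) = 0 by rewrite reduceM xj mul0r.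
    rewrite -(gx j) -{1}xy mulr_suml (bigD1 j) //= big1 ?addr0 => [|j' jj'].
      by rewrite -mulrA yx eqxx mulr1n -scalerAr reduceZ fj scale0r.
    by rewrite -mulrA yx (negPf jj') mulr0n scale0r mulr0.
rewrite (decomposition_dim _ _ _ dec dec) ?mulnn // -reduceM ?ee ?gg //.
Qed.

(** Here d = s e * l will be the degree of e A e and d1 = s 1 * l that of A. *)
Lemma rank_squares i e : e * e = e -> exists d,
  [/\ op_rank c (m i) (sandwich_fun e e) = (d ^ 2)%N &
      exists2 d1, (0 < d1)%N & op_rank c (m i) (sandwich_fun 1 1) = (d1 ^ 2)%N
        /\
        op_rank c (m i) (sandwich_fun e 1) = (d * d1)%N].
Proof.
move=> ee; have [l [s [l0 s1 sl _]]] := central_structure i.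
exists (s e * l)%N; rewrite !sl ?mulr1 //; split; first by rewrite expnMn mulnn.
exists (s 1%R * l)%N; first by rewrite muln_gt0 s1.
by rewrite mulnn expnMn; split=> //; rewrite mulnACA mulnn.
Qed.

End Semilocal.

(** * Brauer equivalence *)

Lemma sandwich_full_dual (R : comNzRingType) (A : algType R) (I : finType)
    (e : I -> A) (phi : I -> {linear A -> R^o}) :
  (forall x, x = \sum_k phi k x *: e k) ->
  (forall k, exists s : seq (A * A),
     forall x, (phi k x : R)%:A = \sum_(w <- s) w.1 * x * w.2) ->
  sandwich_full A.
Proof.
move=> expand /choice[s sE] h.
exists [seq (h (e k) * w.1, w.2) | k <- enum I, w <- s k] => x.
rewrite {1}(expand x) linear_sum big_allpairs_dep /= big_enum /=.
apply: eq_bigr => k _; rewrite linearZ /=.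
transitivity (h (e k) * (phi k x : R)%:A); first by rewrite -scalerAr mulr1.
by rewrite sE mulr_sumr; apply: eq_bigr => w _; rewrite !mulrA.
Qed.

Lemma scalar_linear (R : comNzRingType) (A : algType R) (M : lmodType R)
    (phi : {linear M -> R^o}) : linear (fun x => (phi x : R)%:A : A).
Proof. by move=> a x y; rewrite linearP scalerDl scalerA. Qed.

Section EndAlgebra.
Variables (R : comNzRingType) (P : lmodType R) (c : coordinates P) (fP :
  faithful P).
Local Notation n := (cdim c).
Local Notation E := (end_alg fP).

Definition rank1_fun (phi : {linear P -> R^o}) (v : P) : P -> P :=
  fun x => (phi x : R) *: v.

Lemma rank1_linear phi v : linear (rank1_fun phi v).
Proof. by move=> a x y; rewrite /rank1_fun linearP scalerDl scalerA. Qed.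

Definition rank1 phi v : E := to_linear (rank1_linear phi v).

Lemma coord_linear k : linear (fun x => cmap c x 0 k : R^o).
Proof. by move=> a x y; rewrite linearP !mxE. Qed.

Definition coord_form k : {linear P -> R^o} := to_linear (coord_linear k).

Definition end_unit (p : 'I_n * 'I_n) : E :=
  rank1 (coord_form p.2) (coord_basis p.1).

Lemma end_coord_linear (p : 'I_n * 'I_n) :
  linear (fun h : E => coord_form p.1 (end_app h (coord_basis p.2))).
Proof. by move=> a h g; rewrite -linearP. Qed.

Definition end_coord p : {linear E -> R^o} := to_linear (end_coord_linear p).

Lemma end_app_linear (h : E) : linear (end_app h).
Proof. exact: (linearP (h : {linear P -> P})). Qed.

Lemma end_expand (h : E) : h = \sum_p (end_coord p h : R) *: end_unit p.
Proof.
apply: end_alg_ext => x; rewrite end_app_sumZ.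
rewrite {1}(coord_expand c x) (linear_sumZ _ _ _ _ (end_app_linear h)).
rewrite (eq_bigr (fun p => (end_coord (p.1, p.2) h : R) *: end_app (end_unit
  (p.1, p.2)) x)); last by case.
rewrite -(pair_bigA _ (fun j k =>
  (end_coord (j, k) h : R) *: end_app (end_unit (j, k)) x)) /=.
rewrite exchange_big; apply: eq_bigr => k _ /=.
rewrite {1}(coord_expand c (end_app h _)) scaler_sumr; apply: eq_bigr => j _.
by rewrite /rank1_fun /= !scalerA mulrC.
Qed.

Definition end_coordinates : coordinates E := dual_coordinates end_expand.

(** The matrix identity sum_s E_sj h E_ks = h_jk 1, which also holds for the rank one maps attached
    to a dual basis. *)
Lemma end_sandwich_full : sandwich_full E.
Proof.
apply: (sandwich_full_dual end_expand) => -[j k].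
exists [seq (end_unit (s, j), end_unit (k, s)) | s <- enum 'I_n] => h.
apply: end_alg_ext => x; rewrite big_map big_enum end_app_sum /=.
rewrite -[LHS]/(cmap c (end_app h (coord_basis k)) 0 j *: x).
rewrite {1}(coord_expand c x) scaler_sumr; apply: eq_bigr => s _.
rewrite -[RHS]/(cmap c (end_app h (cmap c x 0 s *: coord_basis k)) 0 j *:
  coord_basis s).
by rewrite (linear_scale _ _ (end_app_linear h)) [cmap c (_ *: _)]linearZ /=
  mxE !scalerA mulrC.
Qed.

Lemma end_faithful : faithful E.
Proof.
move=> r r0; apply: fP => x.
exact: (congr1 (fun h : E => end_app h x) (r0 1)).
Qed.

End EndAlgebra.

Section TensorAlgebra.
Variables (R : comNzRingType) (A E C : algType R).
Variables (cA : coordinates A) (cE : coordinates E).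
Variables (i : {lrmorphism A -> C}) (j : {lrmorphism E -> C}).
Hypothesis ij : forall a h, i a * j h = j h * i a.
Hypothesis tC : is_tensor_product (fun a h => i a * j h).

Lemma tensor_mul a b h g : i a * j h * (i b * j g) = i (a * b) * j (h * g).
Proof. by rewrite !rmorphM !mulrA -(mulrA (i a) (j h)) -(ij b h) !mulrA. Qed.

Lemma tensor_linear_ext (V : lmodType R) (f g : C -> V) : linear f ->
  linear g ->
  (forall a h, f (i a * j h) = g (i a * j h)) -> f =1 g.
Proof.
move=> fl gl fg t; have [l [_ ex]] := tensor_expand cA cE tC; rewrite (ex t).
rewrite !linear_sumP //; apply: eq_bigr => s _.
by rewrite !linear_sumZ //; apply: eq_bigr => k _; rewrite fg.
Qed.

(** Products of dual bases form a dual basis of C, and products of the sandwiches for the two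
    factors represent its forms. *)
Lemma tensor_coordinates : sandwich_full A -> sandwich_full E ->
  exists cC : coordinates C, sandwich_full C.
Proof.
move=> A_full E_full; have [l [lE ex]] := tensor_expand cA cE tC.
pose I := ('I_(cdim cA) * 'I_(cdim cE))%type.
pose u (p : I) : C := i (coord_basis p.1) * j (coord_basis p.2).
have expand (t : C) : t = \sum_(p : I) l p.1 p.2 t *: u p.
  by rewrite {1}(ex t) pair_bigA.
exists (dual_coordinates expand).
apply: (sandwich_full_dual expand) => -[s k] /=.
have [sA sAE] := A_full (to_linear (scalar_linear A (coord_form s))).
have [sE sEE] := E_full (to_linear (scalar_linear E (coord_form k))).
exists [seq (i v.1 * j w.1, i v.2 * j w.2) | v <- sA, w <- sE] => t.
apply: (tensor_linear_ext (f := fun t => (l s k t : R)%:A)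
  (g := fun t => \sum_(w <- _) w.1 * t * w.2)).
- exact: scalar_linear.
- move=> a x y; rewrite scaler_sumr -big_split; apply: eq_bigr => w _ /=.
  by rewrite mulrDr mulrDl -scalerAr -scalerAl.
move=> a h; rewrite lE big_allpairs_dep /=.
transitivity (i ((coord_form s a : R)%:A) * j ((coord_form k h : R)%:A)).
  rewrite !linearZ !rmorph1 -scalerAl mul1r scalerA //.
move: (sAE a) (sEE h) => /= -> ->.
rewrite !linear_sum mulr_suml; apply: eq_bigr => v _.
rewrite mulr_sumr; apply: eq_bigr => w _.
by rewrite !tensor_mul.
Qed.

Lemma tensor_faithful : faithful A -> faithful E -> faithful C.
Proof.
move=> fA fE r r0; have [l [lE ex]] := tensor_expand cA cE tC.
apply: fE => h; rewrite (coord_expand cE h) scaler_sumr big1 // => k _.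
rewrite scalerA; suff -> : r * cmap cE h 0 k = 0 by rewrite scale0r.
apply: fA => a; rewrite (coord_expand cA a) scaler_sumr big1 // => s _.
rewrite scalerA; suff -> : r * cmap cE h 0 k * cmap cA a 0 s = 0 by rewrite
  scale0r.
have := congr1 (l s k) (r0 (i a * j h)).
rewrite linearZ linear0 /= lE => <-.
by rewrite -mulrA [X in r * X]mulrC.
Qed.

End TensorAlgebra.

Lemma functionalZ (R : comNzRingType) (P : lmodType R) (phi : {linear P ->
  R^o}) r x :
  (phi (r *: x) : R) = r * phi x.
Proof. by rewrite linearZ. Qed.

(** At each maximal ideal some coordinate of some generator is nonzero. Gluing these vectors and
    coordinate forms separately gives a form whose value on the glued vector is a unit. *)
Lemma unimodular_vector (R : comNzRingType) (S : maximal_spectrum R)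
    (P : lmodType R) (c : coordinates P) : faithful P ->
  exists (v : P) (phi : {linear P -> R^o}), phi v = 1.
Proof.
move=> fP.
have /fin_all_exists[j /fin_all_exists[k jkP]] (a : 'I_(nmax S)) :=
  faithful_coord c (max_ideal a) fP.
have [d dE] := chinese S.
pose v := \sum_a d a *: coord_basis (j a).
pose psi x : R^o := \sum_a d a * cmap c x 0 (k a).
have psil : linear psi.
  move=> b x y; rewrite -[RHS]/(b * psi x + psi y) /psi mulr_sumr -big_split /=.
  by apply: eq_bigr => a _; rewrite linearP !mxE mulrDr mulrCA.
have [u uE] : exists u : R, u * psi v = 1.
  apply: (unit_mod_max (S := S)) => a; have := jkP a; rewrite -!residue_eq0.
  have red (F : 'I_(nmax S) -> R) :
      residue (max_ideal a) (\sum_b d b * F b) = residue (max_ideal a) (F a).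
    rewrite residue_sum (bigD1 a) //= residueM dE eqxx mul1r big1 ?addr0 // =>
      b ba.
    by rewrite residueM dE eq_sym (negPf ba) mul0r.
  have vE : cmap c v 0 (k a) = \sum_b d b * cmap c (coord_basis (j b)) 0 (k a).
    by rewrite /v linear_sum summxE; apply: eq_bigr => b _; rewrite linearZ mxE.
  by rewrite (red (fun b => cmap c v 0 (k b))) vE red.
have phil : linear (fun x => u * psi x : R^o).
  by move=> b x y; rewrite psil mulrDr mulrCA.
by exists v, (to_linear phil).
Qed.

Section TensorCorner.
Variables (R : comNzRingType) (A : algType R) (cA : coordinates A).
Variables (P : lmodType R) (cP : coordinates P) (fP : faithful P).
Local Notation E := (end_alg fP).
Variables (v : P) (phi : {linear P -> R^o}).
Hypothesis phi_v : phi v = 1.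
Variables (C : algType R) (cC : coordinates C).
Variables (i : {lrmorphism A -> C}) (j : {lrmorphism E -> C}).
Hypothesis ij : forall a h, i a * j h = j h * i a.
Hypothesis tC : is_tensor_product (fun a h => i a * j h).

Definition eta : E := rank1 fP phi v.

Lemma eta_idem : eta * eta = eta.
Proof.
apply: end_alg_ext => x; rewrite -[LHS]/((phi (phi x *: v) : R) *: v).
by rewrite functionalZ phi_v mulr1.
Qed.

Lemma eta_corner (h : E) : eta * h * eta = (phi (end_app h v) : R) *: eta.
Proof.
apply: end_alg_ext => x.
rewrite -[LHS]/((phi (end_app h ((phi x : R) *: v)) : R) *: v).
rewrite (linear_scale _ _ (end_app_linear h)) functionalZ.
rewrite -[RHS]/((phi (end_app h v) : R) *: ((phi x : R) *: v)).
by rewrite scalerA mulrC.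
Qed.

(** As eta E eta = R eta, this identifies A with the corner of C at 1 (x) eta. *)
Definition tensor_eta (a : A) : C := i a * j eta.

Lemma tensor_eta_linear : linear tensor_eta.
Proof. by move=> r x y; rewrite /tensor_eta linearP mulrDl -scalerAl. Qed.

Lemma tensor_etaM a b : tensor_eta a * tensor_eta b = tensor_eta (a * b).
Proof. by rewrite /tensor_eta (tensor_mul ij) eta_idem. Qed.

(** G sends a (x) h to phi(h v) a, the scalar being the one by which eta h eta is a multiple of
    eta. *)
Lemma tensor_retract : exists G : {linear C -> A},
  (forall a, G (tensor_eta a) = a) /\
  forall e c, tensor_eta e * c * tensor_eta e = tensor_eta (e * G c * e).
Proof.
have [|G [[Gl GE] _]] := tC.2 A (fun a h => (phi (end_app h v) : R) *: a).
  split=> [h|a] r x y /=; first by rewrite scalerDr !scalerA mulrC.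
  rewrite -[LHS]/((phi (r *: end_app x v + end_app y v) : R) *: a).
  by rewrite linearP scalerDl scalerA.
exists (to_linear Gl); split=> [a|e c] /=.
  rewrite GE; have -> : end_app eta v = (phi v : R) *: v by [].
  by rewrite phi_v scale1r phi_v scale1r.
apply: (tensor_linear_ext cA (end_coordinates cP fP) tC
  (f := fun c => tensor_eta e * c * tensor_eta e)
  (g := fun c => tensor_eta (e * to_linear Gl c * e))).
- by move=> r x y; rewrite mulrDr mulrDl -scalerAr -scalerAl.
- move=> r x y; rewrite linearP mulrDr mulrDl -scalerAr -scalerAl.
  exact: tensor_eta_linear.
move=> a h; rewrite /= GE -scalerAr -scalerAl (linear_scale _ _
  tensor_eta_linear).
by rewrite /tensor_eta !(tensor_mul ij) eta_corner linearZ -scalerAr.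
Qed.

Lemma tensor_corner_rank p (e : A) (ee : e * e = e) : e != 0 ->
  op_rank cC p (sandwich_fun (tensor_eta e) (tensor_eta e)) =
  op_rank cA p (sandwich_fun e e).
Proof.
move=> e0; have [G [Geta etaG]] := tensor_retract.
rewrite -(corner_rk cA ee e0).
pose f : {linear corner ee e0 -> C} :=
  to_linear tensor_eta_linear \o corner_inj ee e0.
pose g : {linear C -> corner ee e0} :=
  to_linear (corner_proj_linear ee e0) \o G.
have fK : cancel f g.
  by move=> x; rewrite /f /g /= Geta corner_valK.
rewrite (retract_rk cC fK); congr (op_rank cC p _); apply/funext => c.
by rewrite /sandwich_fun etaG.
Qed.

Section Minimal.
Variables (S : maximal_spectrum R) (fA : faithful A) (fC : faithful C).
Local Notation redA a := (@reduce R A cA (max_ideal a) (max_idealP a) fA).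
Local Notation redC a := (@reduce R C cC (max_ideal a) (max_idealP a) fC).

(** An idempotent f below [tensor_eta e] is the image of e G(f) e. Being R-linear, G and
    [tensor_eta] preserve vanishing modulo m, so fullness passes both ways. *)
Lemma tensor_eta_minimal e :
  minimal_full S cA fA e -> minimal_full S cC fC (tensor_eta e).
Proof.
move=> [ee efull emin]; have [G [Geta etaG]] := tensor_retract.
have redG a x : redC a x = 0 -> redA a (G x) = 0.
  move=> /reduce_eq0 x0; rewrite {1}(coord_expand cC x) linear_sum reduce_sum.
  apply: big1 => k _; rewrite linearZ reduceZ.
  by have /eqP := x0 k; rewrite eqb_id -residue_eq0 => /eqP ->; rewrite scale0r.
have redeta a x : redA a x = 0 -> redC a (tensor_eta x) = 0.
  move=> /reduce_eq0 x0; rewrite {1}(coord_expand cA x).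
  rewrite (linear_sumZ _ _ _ _ tensor_eta_linear) reduce_sum.
  apply: big1 => k _; rewrite reduceZ.
  by have /eqP := x0 k; rewrite eqb_id -residue_eq0 => /eqP ->; rewrite scale0r.
split; first by rewrite tensor_etaM ee.
  by move=> a; apply: contra_neq (efull a) => /redG; rewrite Geta.
move=> f ff ef fe ffull.
pose x := e * G f * e.
have fE : f = tensor_eta x by rewrite -etaG ef fe.
suff xe : x = e by rewrite fE xe.
apply: emin.
- by rewrite -(Geta (x * x)) -tensor_etaM -fE ff fE Geta.
- by rewrite /x !mulrA ee.
- by rewrite /x -!mulrA ee.
- by move=> a; apply: contra_neq (ffull a); rewrite [in redC _ _]fE => /redeta.
Qed.

End Minimal.
End TensorCorner.

Lemma rk_algebra (R : comNzRingType) (A : algType R) (c : coordinates A) p :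
  rk A p = op_rank c p (sandwich_fun 1 1).
Proof.
have idK : cancel (idfun : {linear A -> A}) (idfun : {linear A -> A}) by [].
rewrite (retract_rk c idK); congr (op_rank c p _); apply/funext => x.
by rewrite /sandwich_fun mul1r mulr1.
Qed.

Lemma brauer_rank (R : comNzRingType) (S : maximal_spectrum R)
    (A B : algType R) (cA : coordinates A) (fA : faithful A) e
    (ee : e * e = e) (e0 : e != 0) :
  azumaya A -> azumaya B -> brauer_equiv A B -> minimal_full S cA fA e ->
  forall a : 'I_(nmax S), exists k,
    rk B (max_ideal a) = (k ^ 2 * rk (corner ee e0) (max_ideal a))%N.
Proof.
move=> azA azB [P [Q [fP [fQ [gP gQ [C [tA tB]]]]]]] emin a.
have [cP _] := fg_projective_coordinates gP.
have [cQ _] := fg_projective_coordinates gQ.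
have [cB _] := fg_projective_coordinates azB.1.
have [i [j [ij tC]]] := tA; have [i' [j' [ij' tC']]] := tB.
have [v [phi phi_v]] := unimodular_vector S cP fP.
have [w [psi psi_w]] := unimodular_vector S cQ fQ.
have [cC C_full] := tensor_coordinates cA (end_coordinates cP fP) ij tC
  (azumaya_sandwich_full azA) (@end_sandwich_full R P cP fP).
have fC := tensor_faithful cA (end_coordinates cP fP) tC fA (@end_faithful R P
  fP).
have Cmin := tensor_eta_minimal cP phi_v cC ij tC fC emin.
pose g := tensor_eta w psi i' j' 1.
have gg : g * g = g by rewrite (tensor_etaM psi_w ij') mulr1.
have [k [f [x [y [ff dec]]]]] := minimal_decomposition C_full Cmin gg.
have [Ce _ _] := Cmin.
have [k' kE] := decomposition_rank cC fC a Ce gg ff dec.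
exists k'; rewrite (rk_algebra cB) -(tensor_corner_rank cB cQ psi_w cC ij' tC')
  ?mulr1 ?oner_neq0 //.
by rewrite (corner_rk cA) -(tensor_corner_rank cA cP phi_v cC ij tC).
Qed.

Section IdempotentModule.
Variables (R : comNzRingType) (k : nat) (f : 'I_k -> R).

(* The direct sum of the ideals f_j R, provided the f_j are idempotent *)
Definition idem_module_pred : pred 'rV[R]_k :=
  fun v => [forall j, f j * v 0 j == v 0 j].

Fact idem_module_submod_closed : submod_closed idem_module_pred.
Proof.
split=> [|a u v /forallP uP /forallP vP]; apply/forallP => j.
  by rewrite mxE mulr0.
by rewrite !mxE mulrDr mulrCA (eqP (uP j)) (eqP (vP j)).
Qed.

HB.instance Definition _ :=
  GRing.isSubmodClosed.Build R 'rV[R]_k idem_module_pred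
    idem_module_submod_closed.

Record idem_module : Type :=
  IdemModule { idem_module_val :> 'rV[R]_k;
    _ : idem_module_pred idem_module_val }.

HB.instance Definition _ := [isSub for idem_module_val].
HB.instance Definition _ := [Choice of idem_module by <:].
HB.instance Definition _ := [SubChoice_isSubLmodule of idem_module by <:].

Hypothesis ff : forall j, f j * f j = f j.

Fact idem_proj_subproof (v : 'rV[R]_k) :
  idem_module_pred (\row_j (f j * v 0 j)).
Proof. by apply/forallP => j; rewrite mxE mulrA ff. Qed.

Definition idem_proj v : idem_module := IdemModule (idem_proj_subproof v).

Fact idem_proj_linear : linear idem_proj.
Proof.
by move=> a u v; apply: val_inj; apply/rowP => j; rewrite !mxE mulrDr mulrCA.
Qed.

Definition idem_inj : {linear idem_module -> 'rV[R]_k} := val.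

Lemma idem_valK : cancel idem_inj (to_linear idem_proj_linear).
Proof.
move=> v; apply: val_inj; apply/rowP => j; rewrite mxE.
by case: v => v /= /forallP/(_ j)/eqP.
Qed.

Definition idem_coordinates : coordinates idem_module := Coordinates idem_valK.

Lemma idem_basis a b : idem_inj (coord_basis (c :=
  idem_coordinates) b) 0 a = f a *+ (a == b).
Proof. by rewrite mxE mxE eqxx /= mulr_natr. Qed.

Lemma idem_module_faithful :
  (forall r, (forall j, r * f j = 0) -> r = 0) -> faithful idem_module.
Proof.
move=> H r r0; apply: H => j.
have := congr1 (fun v : idem_module => idem_module_val v 0 j)
  (r0 (coord_basis (c := idem_coordinates) j)).
rewrite mxE [X in _ * X]idem_basis eqxx mulr1n => ->.
by rewrite mxE.
Qed.

End IdempotentModule.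

Lemma to_lrmorphism (R : comNzRingType) (A B : algType R) (f : A -> B) :
  linear f -> monoid_morphism f -> exists g : {lrmorphism A -> B}, g =1 f.
Proof.
move=> fl fm.
pose g : {lrmorphism A -> B} := HB.pack_for {lrmorphism A -> B} f
  (GRing.isLinear.Build R A B *:%R f fl) (GRing.isMonoidMorphism.Build A B f
    fm).
by exists g.
Qed.

Section TensorUnit.
Variables (R : comNzRingType) (A : algType R) (c : coordinates A).

Definition row1_coordinates : coordinates 'rV[R]_1 :=
  @Coordinates R 'rV[R]_1 1 idfun idfun (fun=> erefl).

Lemma row1_faithful : faithful 'rV[R]_1.
Proof.
move=> r /(_ (const_mx 1)) /(congr1 (fun v : 'rV_1 => v 0 0)).
by rewrite !mxE mulr1.
Qed.

Local Notation E := (end_alg (@row1_faithful)).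

(** With P = R, the algebra A itself can serve as the common algebra C of a Brauer equivalence. *)
Lemma tensor_unit : is_tensor_algebra A E A.
Proof.
pose u : 'rV[R]_1 := delta_mx 0 0.
pose f (h : E) : A := (end_app h u 0 0)%:A.
have uE (v : 'rV[R]_1) : v = v 0 0 *: u.
  by apply/rowP => j; rewrite !ord1 !mxE eqxx mulr1.
have fl : linear f.
  move=> a h g; rewrite /f -[end_app _ u]/(a *: end_app h u + end_app g u).
  by rewrite !mxE scalerDl scalerA.
have fm : monoid_morphism f.
  split=> [|h g]; first by rewrite /f -[end_app 1 u]/u !mxE eqxx scale1r.
  rewrite /f -[end_app (h * g) u]/(end_app h (end_app g u)) [end_app g u in
    LHS]uE.
  rewrite (linear_scale _ _ (end_app_linear h)) mxE mulrC.
  by rewrite -scalerAl mul1r scalerA.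
have [j jE] := to_lrmorphism fl fm.
exists idfun, j; split=> [a h|].
  by rewrite /= jE /f -scalerAl -scalerAr mul1r mulr1.
pose cE := end_coordinates row1_coordinates (@row1_faithful).
apply: (@tensor_criterion R A E A c cE _ (fun s k => coord_form s)).
- split=> [h|a] r x y /=; first by rewrite mulrDl -scalerAl.
  by rewrite linearP mulrDr -scalerAr.
- move=> a; exists [:: (a, 1)]; rewrite big_seq1 /= rmorph1 mulr1 //.
- move=> s k a h /=; rewrite jE /f -scalerAr mulr1 linearZ !mxE mulrC;
  congr (_ * _).
  case: (enum_val k) => x y; rewrite !ord1.
  by [].
Qed.

End TensorUnit.

Section CornerBrauer.
Variables (R : comNzRingType) (A : algType R) (c : coordinates A).
Variables (fA : faithful A) (e : A) (ee : e * e = e) (e0 : e != 0).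
Variables (k : nat) (f : 'I_k -> R) (x y : 'I_k -> A).
Hypotheses (ff : forall j, f j * f j = f j) (dec : decomposition e 1 f x y).
Local Notation eAe := (corner ee e0).
Local Notation Q := (idem_module f).
Local Notation cQ := (idem_coordinates ff).

Let xe a : x a * e = x a. Proof. by case: dec. Qed.
Let ey a : e * y a = y a. Proof. by case: dec => _ _ /(_ a)[]. Qed.
Let yx a b : y a * x b = (f a *+ (a == b)) *: e. Proof. by case: dec. Qed.
Let xy1 : \sum_a x a * y a = 1. Proof. by case: dec. Qed.

Let fx a : f a *: x a = x a.
Proof.
rewrite -[RHS]mul1r -xy1 mulr_suml (bigD1 a) //= big1 ?addr0 => [|b ba].
  by rewrite -mulrA yx eqxx mulr1n -scalerAr xe.
by rewrite -mulrA yx (negPf ba) mulr0n scale0r mulr0.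
Qed.

Let fy a : f a *: y a = y a.
Proof.
rewrite -[RHS]mulr1 -xy1 mulr_sumr (bigD1 a) //= big1 ?addr0 => [|b ba].
  by rewrite mulrA yx eqxx mulr1n -scalerAl ey.
by rewrite mulrA yx eq_sym (negPf ba) mulr0n scale0r mul0r.
Qed.

Lemma decomposition_annihilator r : (forall j, r * f j = 0) -> r = 0.
Proof.
move=> rf; apply: fA => a;
  rewrite -[a]mul1r -xy1 mulr_suml scaler_sumr big1 // => j _.
by rewrite -(fx j) -!scalerAl scalerA rf scale0r.
Qed.

Let fQ : faithful Q := @idem_module_faithful R k f ff decomposition_annihilator.
Local Notation E := (end_alg fQ).

Lemma decomposition_corner_faithful : faithful eAe.
Proof.
move=> r r0; apply: fA => a.
have re : r *: e = 0 by have := congr1 (@corner_val R A e ee e0) (r0 1).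
rewrite -[a]mul1r -xy1 mulr_suml scaler_sumr big1 // => j _.
by rewrite -(xe j) -!mulrA scalerAr scalerAl re mul0r mulr0.
Qed.

Let phi a b (h : E) : R := end_coord (c := cQ) fQ (a, b) h.

Let phiE a b h : phi a b h = idem_inj f (end_app h (coord_basis (c :=
  cQ) b)) 0 a.
Proof. by []. Qed.

Let fphi a b h : f a * phi a b h = phi a b h.
Proof.
rewrite phiE; case: (end_app h _) => v vP /=.
by have /forallP/(_ a)/eqP := vP.
Qed.

Let phif a b h : f b * phi a b h = phi a b h.
Proof.
rewrite !phiE; set q := coord_basis (c := cQ) b.
have -> : f b * idem_inj f (end_app h q) 0 a = idem_inj f (end_app h (f b *:
  q)) 0 a.
  by rewrite (linear_scale _ _ (end_app_linear h)) linearZ mxE.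
congr (idem_inj f (end_app h _) 0 a); apply: val_inj; apply/rowP => d.
rewrite /= !mxE eqxx /=; case: (d =P b) => [->|_]; last by rewrite !mulr0.
by rewrite !mulr1 ff.
Qed.

Let phi_linear a b r g h : phi a b (r *: g + h) = r * phi a b g + phi a b h.
Proof. by rewrite /phi linearP. Qed.

Let phiM a b (g h : E) : phi a b (g * h) = \sum_d phi a d g * phi d b h.
Proof.
rewrite phiE -[end_app _ _]/(end_app g (end_app h (coord_basis (c := cQ) b))).
rewrite {1}(coord_expand cQ (end_app h _)) (linear_sumZ _ _ _ _ (end_app_linear
  g)).
rewrite linear_sum summxE; apply: eq_bigr => d _.
by rewrite linearZ mxE mulrC.
Qed.

Let phi1 a b : phi a b 1 = f a *+ (a == b).
Proof. by rewrite phiE idem_basis. Qed.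

Let phi_unit a b d d' : phi a b (end_unit (c := cQ) fQ (d, d')) =
  f d' *+ (d' == b) * (f a *+ (a == d)).
Proof.
rewrite phiE -[end_app _ _]/(idem_inj f (coord_basis (c :=
  cQ) b) 0 d' *: coord_basis (c := cQ) d).
by rewrite linearZ mxE !idem_basis.
Qed.

(** Viewing t in A as the matrix of entries y_a t x_b over e A e, w becomes a diagonal matrix, and
    [inj_end] sends h to its matrix of scalars. *)
Let inj_corner (w : eAe) : A := \sum_a x a * val w * y a.
Let inj_end (h : E) : A := \sum_a \sum_b phi a b h *: (x a * y b).

Let inj_mul (w : eAe) (h : E) :
  inj_corner w * inj_end h = \sum_a \sum_b phi a b h *: (x a * val w * y b).
Proof.
have [ew we] := cornerP w.
rewrite mulr_sumr; apply: eq_bigr => a _; rewrite mulr_sumr;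
  apply: eq_bigr => b _.
rewrite -scalerAr; congr (_ *: _); rewrite mulr_suml (bigD1 a) //= big1 ?addr0.
  rewrite !mulrA -(mulrA _ (y a) (x a)) yx eqxx mulr1n -scalerAr -!scalerAl.
  by rewrite -(mulrA (x a) _ e) we !scalerAl fx.
move=> d da; rewrite !mulrA -(mulrA _ (y d) (x a)) yx (negPf da).
by rewrite mulr0n scale0r mulr0 mul0r.
Qed.

Let inj_comm (w : eAe) (h : E) : inj_corner w * inj_end h = inj_end h *
  inj_corner w.
Proof.
have [ew we] := cornerP w.
rewrite inj_mul mulr_suml; apply: eq_bigr => a _.
rewrite mulr_suml; apply: eq_bigr => b _.
rewrite -scalerAl; congr (_ *: _); rewrite mulr_sumr (bigD1 b) //= big1 ?addr0.
  rewrite !mulrA -(mulrA (x a) (y b)) yx eqxx mulr1n -scalerAr xe -!scalerAl.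
  by rewrite scalerAr fy.
move=> d db; rewrite !mulrA -(mulrA (x a) (y b)) yx eq_sym (negPf db).
by rewrite mulr0n scale0r mulr0 !mul0r.
Qed.

Let inj_corner_linear : linear inj_corner.
Proof.
move=> r u v; rewrite /inj_corner scaler_sumr -big_split;
  apply: eq_bigr => a _ /=.
by rewrite mulrDr mulrDl -scalerAr -scalerAl.
Qed.

Let inj_corner_monoid : monoid_morphism inj_corner.
Proof.
split=> [|u v].
  by rewrite -xy1; apply: eq_bigr => a _; rewrite /= xe.
have [ev ve] := cornerP v.
rewrite mulr_suml; apply: eq_bigr => a _;
  rewrite mulr_sumr (bigD1 a) //= big1 ?addr0.
  rewrite !mulrA -(mulrA _ (y a) (x a)) yx eqxx mulr1n -scalerAr -!scalerAl.
  by rewrite -(mulrA _ e (val v)) ev !scalerAl fx.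
move=> b ba; rewrite !mulrA -(mulrA _ (y a) (x b)) yx eq_sym (negPf ba).
by rewrite mulr0n scale0r mulr0 !mul0r.
Qed.

Let inj_end_linear : linear inj_end.
Proof.
move=> r u v; rewrite /inj_end scaler_sumr -big_split; apply: eq_bigr => a _ /=.
rewrite scaler_sumr -big_split; apply: eq_bigr => b _ /=.
by rewrite phi_linear scalerDl scalerA.
Qed.

Let inj_end_monoid : monoid_morphism inj_end.
Proof.
split=> [|g h].
  rewrite -[RHS]xy1; apply: eq_bigr => a _.
  rewrite (bigD1 a) //= phi1 eqxx mulr1n big1 ?addr0 => [|b ba].
    by rewrite scalerAl fx.
  by rewrite phi1 eq_sym (negPf ba) mulr0n scale0r.
rewrite mulr_suml; apply: eq_bigr => a _.
transitivity (\sum_b \sum_d (phi a d g * phi d b h) *: (x a * y b)).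
  by apply: eq_bigr => b _; rewrite phiM scaler_suml.
rewrite exchange_big mulr_suml; apply: eq_bigr => d _ /=.
rewrite mulr_sumr [RHS](bigD1 d) //= [X in _ + X]big1 ?addr0 => [|a' a'd].
  rewrite mulr_sumr; apply: eq_bigr => b _.
  rewrite -scalerAr -scalerAl scalerA -!mulrA (mulrA (y d)) yx eqxx mulr1n.
  by rewrite -scalerAl ey -scalerAr scalerA mulrAC [_ * f d]mulrC fphi mulrC.
rewrite mulr_sumr big1 // => b _.
rewrite -scalerAr -scalerAl -!mulrA (mulrA (y d)) yx eq_sym (negPf a'd).
by rewrite mulr0n scale0r mul0r mulr0 !scaler0.
Qed.

(** The forms for [tensor_criterion] read off the coordinates of the entries y_a t x_b. Pure tensors
    span because inserting 1 = sum x_d y_d on both sides of t splits it into matrix entries. *)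
Lemma decomposition_tensor : is_tensor_algebra eAe E A.
Proof.
have [i iE] := to_lrmorphism inj_corner_linear inj_corner_monoid.
have [j jE] := to_lrmorphism inj_end_linear inj_end_monoid.
exists i, j; split=> [w h|]; first by rewrite iE jE inj_comm.
have lP s (p : 'I_k * 'I_k) : linear (fun a =>
  cmap c (y p.1 * a * x p.2) 0 s : R^o).
  by move=> r a b; rewrite mulrDr mulrDl -scalerAr -scalerAl linearP !mxE.
apply: (@tensor_criterion R eAe E A (corner_coordinates c ee e0)
  (end_coordinates cQ fQ)
  _ (fun s q => to_linear (lP s (enum_val q)))).
- split=> [h|w] r u v /=; first by rewrite linearP mulrDl -scalerAl.
  by rewrite linearP mulrDr -scalerAr.
- move=> a.
  have -> : a = \sum_d \sum_d' i (corner_proj ee e0 (y d * a * x d')) *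
      j (end_unit (c := cQ) fQ (d, d')).
    rewrite -[LHS]mul1r -[LHS]mulr1 -[in LHS]xy1 mulr_suml mulr_suml.
    apply: eq_bigr => d _; rewrite mulr_sumr; apply: eq_bigr => d' _.
    rewrite iE jE inj_mul (bigD1 d) //= [X in _ + X]big1 ?addr0 => [|b bd].
      rewrite (bigD1 d') //= [X in _ + X]big1 ?addr0 => [|b bd'].
        rewrite phi_unit !eqxx !mulr1n /= !mulrA xe -(mulrA _ (x d') e) xe.
        by rewrite -scalerA !scalerAl fx -!scalerAl scalerAr fy.
      by rewrite phi_unit eq_sym (negPf bd') mulr0n mul0r scale0r.
    by rewrite big1 // => b' _;
      rewrite phi_unit (negPf bd) mulr0n mulr0 scale0r.
  by do 2! (apply: tensor_span_sum => ? _); apply: tensor_span1.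
move=> s q w h /=; rewrite iE jE inj_mul.
have [ew we] := cornerP w.
case qE: (enum_val q) => [a b] /=.
have -> : y a * (\sum_d \sum_d' phi d d' h *: (x d * val w * y d')) * x b =
    (f a * f b * phi a b h) *: val w.
  rewrite mulr_sumr mulr_suml (bigD1 a) //= [X in _ + X]big1 ?addr0 => [|d da].
    rewrite mulr_sumr mulr_suml (bigD1 b) //= [X in _ + X]big1 ?addr0 =>
      [|d' d'b].
      rewrite -scalerAr -scalerAl !mulrA yx eqxx mulr1n -(mulrA _ (y b)) yx
        eqxx mulr1n.
      rewrite -!scalerAl -scalerAr ew we !scalerA; congr (_ *: _).
      by rewrite -mulrA mulrC.
    rewrite -scalerAr -scalerAl -!mulrA yx (negPf d'b) mulr0n scale0r.
    by rewrite !mulr0 scaler0.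
  rewrite mulr_sumr mulr_suml big1 // => d' _.
  rewrite -scalerAr -scalerAl !mulrA yx eq_sym (negPf da) mulr0n scale0r.
  by rewrite !mul0r scaler0.
rewrite linearZ mxE mulrC; congr (_ * _).
by rewrite -mulrA phif fphi mxE qE.
Qed.

Lemma decomposition_brauer_equiv : brauer_equiv A eAe.
Proof.
exists 'rV[R]_1, Q, (@row1_faithful R), fQ; split.
- exact: coordinates_fg_projective (row1_coordinates R).
- exact: coordinates_fg_projective cQ.
- by exists A; split; [exact: tensor_unit c | exact: decomposition_tensor].
Qed.

End CornerBrauer.

(** * Degrees, the index and the final assembly *)

Lemma deg_eq (R : comNzRingType) (A : algType R) p d :
  rk A p = (d ^ 2)%N -> deg A p = d.
Proof.
rewrite /deg => ->; case: xgetP => [d' _ /= /eqP|/(_ d)]; last by case.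
by rewrite eqn_sqr => /eqP.
Qed.

Lemma set_gcd_eq (X : set nat) d : X d -> (forall k, X k -> (d %| k)%N) ->
  set_gcd X = d.
Proof.
move=> Xd dX; have dP n : (n %| d)%N <-> forall k, X k -> (n %| k)%N.
  by split=> [nd k /dX|H]; [exact: dvdn_trans | exact: H].
rewrite /set_gcd; case: xgetP => [g _ /= gP|/(_ d) /=]; last by case.
by apply/eqP; rewrite eqn_dvd; apply/andP; split; [apply/dP/gP | apply/gP/dP].
Qed.

Theorem theorem1p25 (R : comNzRingType) (R_semilocal : semilocal R)
    (two_unit : exists u : R, 2%:R * u = 1)
    (A : algType R) (A_azumaya : azumaya A) :
  exists (e : A) (eI : e * e = e) (e_neq0 : e != 0),
    in_brauer_class A (corner eI e_neq0) /\
    forall p : prime_idealr R,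
      rrk A (right_ideal e) p = (deg (corner eI e_neq0) p)%:R /\
      deg (corner eI e_neq0) p = ind A p.
Proof.
have [S] := semilocal_spectrum R_semilocal.
have A_full := azumaya_sandwich_full A_azumaya.
have [A_proj [fA _]] := A_azumaya.
have [c _] := fg_projective_coordinates A_proj.
have [e emin] := minimal_full_exists S c A_full fA.
have [k [f [x [y [ff dec]]]]] := minimal_decomposition A_full emin (mulr1 1).
have [eI _ _] := emin.
have e_neq0 : e != 0.
  have [_ _ _ _ xy] := dec; apply: contra_neq (oner_neq0 A) => e0.
  have [_ xe _ _ _] := dec.
  by rewrite -xy big1 // => j _; rewrite -xe e0 mulr0 mul0r.
exists e, eI, e_neq0.
have corner_faithful : faithful (corner eI e_neq0).
  exact: decomposition_corner_faithful dec.
have corner_az := corner_azumaya c A_azumaya corner_faithful.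
have corner_class : in_brauer_class A (corner eI e_neq0).
  by split=> //; exact: (decomposition_brauer_equiv c fA eI e_neq0 ff dec).
(* Ranks of projective modules agree at p and at a maximal ideal above it, so all equalities are
   checked there. *)
split=> // p; have [a pa] := max_above S p.
have rk_max (M : lmodType R) : fg_projective M -> rk M p = rk M (max_ideal a).
  by move=> M_proj; apply: rk_prime_sub.
(* The rank of e A is d * d1 with d1 = deg A, which makes the reduced rank d. *)
have [d [eeE [d1 d1_gt0 [oneE eE]]]] := rank_squares c A_full fA a eI.
have corner_rkE : rk (corner eI e_neq0) (max_ideal a) = (d ^ 2)%N.
  by rewrite (corner_rk c).
have degE : deg (corner eI e_neq0) p = d.
  by apply: deg_eq; rewrite rk_max //; exact: corner_az.1.
have degA : deg A p = d1 by apply: deg_eq; rewrite rk_max // (rk_algebra c).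
split.
  rewrite /rrk degE degA rk_max; last exact: right_ideal_projective c e eI.
  by rewrite (right_ideal_rk c) // eE natrM mulfK // Num.Theory.pnatr_eq0 -lt0n.
(* The gcd is attained: e A e is itself in the class, and its degree divides all the others. *)
rewrite degE; apply/esym/set_gcd_eq; first by exists (corner eI e_neq0).
move=> _ [B [[B_az AB] <-]].
have [k' kE] := brauer_rank eI e_neq0 A_azumaya B_az AB emin a.
rewrite (@deg_eq _ _ _ (k' * d)%N) ?dvdn_mull // rk_max; last exact: B_az.1.
by rewrite kE corner_rkE expnMn.
Qed.
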